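(* Let $\beta,\gamma,h\in\mathbb{R}$ with $\gamma\neq 0$, and let $p(\beta,\gamma,h)=\lim_{N\to\infty}p_N(\beta,\gamma,h)$ be the limiting free energy per particle of the Sherrington-Kirkpatrick model with Gaussian random external field (defined in the context). Suppose that the map $x\mapsto p(\beta,x,h)$ is differentiable at $x=\gamma$. Then the Ghirlanda-Guerra identities hold at $(\beta,\gamma,h)$; that is, for every positive integer $n$ and every bounded measurable function $f:\mathbb{R}^{n(n-1)/2}\to\mathbb{R}$ (not depending on $N$), $$\lim_{N\to\infty}\delta_N(\beta,\gamma,h)=0,$$ where $$\delta_N(\beta,\gamma,h)=\nu(R_{1,n+1}f)-\frac1n\,\nu(R_{1,2})\,\nu(f)-\frac1n\sum_{2\le \ell\le n}\nu(R_{1,\ell}f)$$ and $f=f(\mathcal{R}_n)$ is evaluated at the overlaps $\mathcal{R}_n=(R_{\ell,\ell'})_{1\le \ell<\ell'\le n}$.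
   Context: For each positive integer $N$, let $(g_{ij})_{1\le i<j\le N}$ and $(g_i)_{1\le i\le N}$ be collections of i.i.d. standard Gaussian random variables (all of them jointly independent). For real parameters $\beta,\gamma,h$, define the Hamiltonian $H_N$ on $\{-1,1\}^N$ by $$-H_N(\sigma)=\frac{\beta}{\sqrt N}\sum_{1\le i<j\le N}g_{ij}\sigma_i\sigma_j+h\sum_{1\le i\le N}\sigma_i+\gamma\sum_{1\le i\le N}g_i\sigma_i .$$ The Gibbs measure $G_N$ is the random probability measure on $\{-1,1\}^N$ with $G_N(\{\sigma\})\propto e^{-H_N(\sigma)}$. For a function $F:(\{-1,1\}^N)^m\to\mathbb{R}$, write $$\langle F\rangle=\sum_{\sigma^1,\ldots,\sigma^m}F(\sigma^1,\ldots,\sigma^m)\,G_N(\{\sigma^1\})\cdots G_N(\{\sigma^m\}),\qquad \nu(F)=\mathbb{E}\langle F\rangle,$$ where $\mathbb{E}$ is expectation over the Gaussian variables. Thus $\sigma^1,\sigma^2,\ldots$ (replicas) are i.i.d. configurations from $G_N$ given the Gaussian variables. The overlap of replicas $\sigma^\ell,\sigma^{\ell'}$ is $$R_{\ell,\ell'}=\frac1N\sum_{i=1}^N\sigma_i^\ell\sigma_i^{\ell'}.$$ The free energy per particle is $\psi_N=\frac1N\log\sum_{\sigma\in\{-1,1\}^N}e^{-H_N(\sigma)}$, and $p_N(\beta,\gamma,h)=\mathbb{E}(\psi_N)$. It is known that $p(\beta,\gamma,h)=\lim_{N\to\infty}p_N(\beta,\gamma,h)$ exists for all $\beta,\gamma,h$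 and is convex in each argument. *)

(* Defs.v *)
From HB Require Import structures.
From mathcomp Require Import all_boot all_order all_algebra.
From mathcomp Require Import all_classical all_reals all_analysis.
Import Order.TTheory GRing.Theory Num.Theory.
Import numFieldNormedType.Exports.

Set Implicit Arguments.
Unset Strict Implicit.
Unset Printing Implicit Defensive.

Local Open Scope classical_set_scope.
Local Open Scope ring_scope.

Definition pairs (n : nat) : Type := {e : 'I_n * 'I_n | (e.1 < e.2)%N}.
HB.instance Definition _ n := Finite.on (pairs n).

Lemma card_pairs n : #|{: pairs n}| = (n * n.-1)./2.
Proof.
rewrite card_sig -sum1_card.
rewrite (eq_bigl (fun e : 'I_n * 'I_n => true && (e.1 < e.2)%N)); last first.
  by move=> e; rewrite inE.
rewrite -(pair_big_dep predT (fun i j : 'I_n => (i < j)%N) (fun _ _ => 1%N)) /=.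
rewrite -bin2 -bin2_sum big_mkord.
rewrite (exchange_big_dep predT) //=; apply: eq_bigr => j _.
rewrite -[X in _ = X]subn0 -[RHS]muln1 -sum_nat_const_nat big_mkord.
rewrite -(big_ord_widen n (fun=> 1%N)) ?big_mkord //; exact: ltnW.
Qed.

Section Independence.
Context d (T : measurableType d) (R : realType) (P : probability T R).

Definition mutually_independent (I : finType) (X : I -> {RV P >-> R}) : Prop :=
  forall (J : {set I}) (A : I -> set R),
    (forall i, i \in J -> measurable (A i)) ->
    P (\bigcap_(i in [set` J]) (X i @^-1` A i)) =
      (\prod_(i in J) P (X i @^-1` A i))%E.

Definition iid_standard_gaussian (I : finType) (X : I -> {RV P >-> R}) : Prop :=
  mutually_independent X /\
  forall (i : I) (A : set R), measurable A ->
    distribution P (X i) A = normal_prob 0 1 A.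

End Independence.

Definition config (N : nat) : Type := {ffun 'I_N -> bool}.
HB.instance Definition _ N := Finite.on (config N).

(* [inl e] indexes the coupling g_ij with e = (i, j), i < j; [inr i] indexes
   the external field g_i. *)
Definition disorder (N : nat) : Type := (pairs N + 'I_N)%type.
HB.instance Definition _ N := Finite.on (disorder N).

Section SK.
Context {R : realType} {N : nat}.

Definition spin (s : config N) (i : 'I_N) : R := if s i then 1 else -1.

Definition overlap (s t : config N) : R :=
  N%:R^-1 * \sum_(i < N) spin s i * spin t i.

(* The overlaps R_{l,l'}, 1 <= l < l' <= n, as a point of R^{n(n-1)/2}; the
   order of the coordinates is that of the enumeration of [pairs n]. *)
Definition overlaps (n : nat) (s : 'I_n -> config N) :
    ((n * n.-1)./2).-tuple R :=
  [tuple (let e := val (enum_val (cast_ord (esym (card_pairs n)) k)) in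
          overlap (s e.1) (s e.2)) | k < (n * n.-1)./2].

Definition hamiltonian (beta gamma h : R) (x : disorder N -> R)
    (s : config N) : R :=
  - (beta / Num.sqrt N%:R *
       (\sum_(e : pairs N) x (inl e) * spin s (val e).1 * spin s (val e).2)
     + h * (\sum_(i < N) spin s i)
     + gamma * (\sum_(i < N) x (inr i) * spin s i)).

Definition partition_function (beta gamma h : R) (x : disorder N -> R) : R :=
  \sum_(s : config N) expR (- hamiltonian beta gamma h x s).

Definition gibbs (beta gamma h : R) (x : disorder N -> R) (s : config N) : R :=
  expR (- hamiltonian beta gamma h x s) / partition_function beta gamma h x.

Definition gibbs_mean (beta gamma h : R) (x : disorder N -> R) (m : nat)
    (F : ('I_m -> config N) -> R) : R :=
  \sum_(s : {ffun 'I_m -> config N})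
    F s * \prod_(l < m) gibbs beta gamma h x (s l).

Definition free_energy (beta gamma h : R) (x : disorder N -> R) : R :=
  N%:R^-1 * ln (partition_function beta gamma h x).

Context {d} {T : measurableType d} {P : probability T R}.
Variable g : disorder N -> {RV P >-> R}.

Definition mean_free_energy (beta gamma h : R) : R :=
  fine 'E_P[fun w => free_energy beta gamma h (fun a => g a w)].

Definition nu (beta gamma h : R) (m : nat) (F : ('I_m -> config N) -> R) : R :=
  fine 'E_P[fun w => gibbs_mean beta gamma h (fun a => g a w) F].

(* Replicas are numbered from 0: replica l of the usual numbering is l-1 here.
   The term R_{1,2} uses 2 replicas, f uses n, and R_{1,l} f uses n + 1, with f
   evaluated at the first n. *)
Definition gg_delta (beta gamma h : R) (n : nat)
    (f : ((n * n.-1)./2).-tuple R -> R) : R :=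
  let first_n (s : 'I_n.+1 -> config N) (k : 'I_n) :=
    s (widen_ord (leqnSn n) k) in
  nu beta gamma h (fun s : 'I_n.+1 -> config N =>
      overlap (s ord0) (s ord_max) * f (overlaps (first_n s)))
  - n%:R^-1 *
      nu beta gamma h (fun s : 'I_2 -> config N => overlap (s ord0) (s ord_max)) *
      nu beta gamma h (fun s : 'I_n -> config N => f (overlaps s))
  - n%:R^-1 * \sum_(l < n.+1 | (0 < l < n)%N)
      nu beta gamma h (fun s : 'I_n.+1 -> config N =>
        overlap (s ord0) (s l) * f (overlaps (first_n s))).

End SK.

(* Main.v *)
(* Let L(s) = N^-1 sum_i g_i s_i be the random field per particle. Gaussian integration by parts
   in the g_i gives nu(L f) - nu(L) nu(f) = - gamma n delta_N, so it is enough to show that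
   E < |L - m| > -> 0 for some constant m. The Gibbs average of exp(t N (L - m)) is a ratio of
   partition functions at the fields gamma + t and gamma, hence, by Jensen's inequality and
   exp |y| <= exp y + exp (- y), the quantity < |L - m| > is at most log 2 / (t N) plus the
   distances of the difference quotients of the free energy at gamma +- t to m. The free
   energy is a Lipschitz function of each of the independent Gaussian variables, with squared
   constants of sum O(1 / N); by tensorization of the variance it concentrates, and the
   quotients converge to those of p. Let N tend to infinity, then t to 0, with m = p'(gamma). *)

From HB Require Import structures.
Require Import Defs.
From mathcomp Require Import all_boot all_order all_algebra.
From mathcomp Require Import all_classical all_reals all_analysis.
From mathcomp Require Import measurable_realfun ring lra.
Import Order.TTheory GRing.Theory Num.Theory.
Import numFieldNormedType.Exports.

Set Implicit Arguments.
Unset Strict Implicit.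
Unset Printing Implicit Defensive.

Local Open Scope classical_set_scope.
Local Open Scope ring_scope.

(** * Integrable real functions *)

(** The joint law of the disorder is never built as a product measure over all coordinates.
    Independence and Gaussianity are condensed into one property of that law, its invariance under
    replacing a single coordinate by a fresh standard Gaussian; the second moments, the integration
    by parts and the variance bound all come from it by Fubini's theorem. Integration by parts
    produces the sum of nu(R_{1,l} f) over all l <= n, the term l = 1 included. As R_{1,1} = 1, this
    term is nu(f), and it cancels against the same term in nu(L) nu(f) = gamma (1 - nu(R_{1,2}))
    nu(f). What is left is delta_N with the factor n gamma, which is why gamma must not vanish. The
    constant m does not depend on the disorder, so replacing L by m costs at most sup |f| times E <
    |L - m| > in each of nu(L f) and nu(L) nu(f), and the thermal and the disorder fluctuations of L
    are controlled together. The step t is fixed first, from the precision wanted for the difference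
    quotients of p; only then does N grow, which makes log 2 / (t N) and the concentration error
    negligible although both are divided by t. *)

Section real_integrable.
Context {d} {T : measurableType d} {R : realType} (mu : {measure set T -> \bar R}).
Implicit Types f g : T -> R.

Lemma integrableD_EFin f g :
  mu.-integrable setT (EFin \o f) -> mu.-integrable setT (EFin \o g) ->
  mu.-integrable setT (EFin \o (fun x => f x + g x)).
Proof.
move=> fi gi; have -> : EFin \o (fun x => f x + g x) = ((EFin \o f) \+ (EFin \o g))%E.
  by apply/funext => x; rewrite /= EFinD.
exact: integrableD.
Qed.

Lemma integrableZl_EFin (k : R) f : mu.-integrable setT (EFin \o f) ->
  mu.-integrable setT (EFin \o (fun x => k * f x)).
Proof.
move=> fi; have -> : EFin \o (fun x => k * f x) = (fun x => k%:E * (EFin \o f) x)%E.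
  by apply/funext => x; rewrite /= EFinM.
exact: integrableZl.
Qed.

Lemma integrableB_EFin f g :
  mu.-integrable setT (EFin \o f) -> mu.-integrable setT (EFin \o g) ->
  mu.-integrable setT (EFin \o (fun x => f x - g x)).
Proof.
move=> fi gi; have -> : (fun x => f x - g x) = (fun x => f x + -1 * g x).
  by apply/funext => x; rewrite mulN1r.
by apply: integrableD_EFin => //; exact: integrableZl_EFin.
Qed.

Lemma integrable_norm_EFin f : mu.-integrable setT (EFin \o f) ->
  mu.-integrable setT (EFin \o (fun x => `|f x|)).
Proof. by move=> fi; have := integrable_abse fi. Qed.

Lemma integrable_sum_EFin (I : Type) (s : seq I) (P : pred I) (h : I -> T -> R) :
  (forall i, P i -> mu.-integrable setT (EFin \o h i)) ->
  mu.-integrable setT (EFin \o (fun x => \sum_(i <- s | P i) h i x)).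
Proof.
move=> hi.
have -> : EFin \o (fun x => \sum_(i <- s | P i) h i x) =
    (fun x => \sum_(i <- s | P i) (EFin \o h i) x)%E.
  by apply/funext => x; rewrite /= sumEFin.
exact: integrable_sum.
Qed.

Lemma le_integrable_EFin f g : measurable_fun setT f -> (forall x, `|f x| <= g x) ->
  mu.-integrable setT (EFin \o g) -> mu.-integrable setT (EFin \o f).
Proof.
move=> mf fg; apply: le_integrable => //; first exact/measurable_EFinP.
by move=> x _; rewrite /= lee_fin (le_trans (fg x))// ler_norm.
Qed.

Lemma Rintegral_sum (I : Type) (s : seq I) (P : pred I) (h : I -> T -> R) :
  (forall i, mu.-integrable setT (EFin \o h i)) ->
  \int[mu]_x (\sum_(i <- s | P i) h i x) = \sum_(i <- s | P i) \int[mu]_x h i x.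
Proof.
move=> hi; elim: s => [|i s IH].
  under eq_Rintegral => x _ do rewrite big_nil.
  by rewrite big_nil Rintegral_cst // mul0r.
under eq_Rintegral => x _ do rewrite big_cons.
rewrite big_cons; case: (P i); last exact: IH.
by rewrite RintegralD ?IH//; exact: integrable_sum_EFin.
Qed.

End real_integrable.

Section probability_integrable.
Context {d} {T : measurableType d} {R : realType} (P : probability T R).

Lemma integrable_cst_EFin (k : R) : P.-integrable setT (EFin \o (fun _ => k)).
Proof. exact: finite_measure_integrable_cst. Qed.

Lemma bounded_integrable_EFin (M : R) (f : T -> R) :
  measurable_fun setT f -> (forall x, `|f x| <= M) -> P.-integrable setT (EFin \o f).
Proof.
move=> mf bf; apply: (@le_integrable_EFin _ _ _ P _ (fun=> M)) => //.
exact: integrable_cst_EFin.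
Qed.

Lemma Rintegral_probability_cst (k : R) : \int[P]_x k = k.
Proof. by rewrite Rintegral_cst// [X in fine X](probability_setT P) mulr1. Qed.

Lemma le_Rintegral_affine (c q r : R) (f f1 f2 f3 : T -> R) :
  P.-integrable setT (EFin \o f) -> P.-integrable setT (EFin \o f1) ->
  P.-integrable setT (EFin \o f2) -> P.-integrable setT (EFin \o f3) ->
  (forall x, f x <= c + q * (f1 x + (f2 x + r * f3 x))) ->
  \int[P]_x f x <=
    c + q * (\int[P]_x f1 x + (\int[P]_x f2 x + r * \int[P]_x f3 x)).
Proof.
move=> fi fi1 fi2 fi3 le_f; have ri3 := integrableZl_EFin r fi3.
have i23 := integrableD_EFin fi2 ri3; have i123 := integrableD_EFin fi1 i23.
have qi := integrableZl_EFin q i123; have ci := integrable_cst_EFin c.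
rewrite -{1}(Rintegral_probability_cst c) -(RintegralZl r measurableT fi3).
rewrite -(RintegralD measurableT fi2 ri3) -(RintegralD measurableT fi1 i23).
rewrite -(RintegralZl q measurableT i123) -(RintegralD measurableT ci qi).
by apply: le_Rintegral => //; exact: integrableD_EFin.
Qed.

End probability_integrable.

(** * The standard Gaussian distribution *)

Section gaussian.
Context {R : realType}.
Local Notation leb := (@lebesgue_measure R).
Local Notation gam := (normal_prob (0 : R) 1).

(** Domination by Lebesgue measure gives the formula with the Radon-Nikodym derivative; this
    derivative and [normal_pdf] have the same integral over every measurable set, hence agree almost
    everywhere. *)
Lemma ge0_integral_normal_prob (m s : R) (f : R -> \bar R) :
  (forall x, 0 <= f x)%E -> measurable_fun setT f ->
  (\int[normal_prob m s]_x f x = \int[leb]_x (f x * (normal_pdf m s x)%:E))%E.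
Proof.
move=> f0 mf; have dom := normal_prob_dominates m s.
rewrite -(Radon_Nikodym_SigmaFinite.change_of_variables dom f0 measurableT mf).
have mpdf : measurable_fun setT (EFin \o normal_pdf m s).
  by apply/measurable_EFinP; exact: measurable_normal_pdf.
have iRN := Radon_Nikodym_SigmaFinite.f_integrable dom.
apply: ae_eq_integral => //.
- by apply: emeasurable_funM => //; exact: measurable_int iRN.
- exact: emeasurable_funM.
apply: ae_eqe_mul2l; apply: integral_ae_eq => //= E _ mE.
by rewrite -(Radon_Nikodym_SigmaFinite.f_integral dom).
Qed.

(** With y = x^2, the inequality y / 4 <= exp (y / 4) absorbs the square into half of the exponent,
    which leaves the shape of the normal density of variance 2. As that density has integral 1, the
    second moment of the standard Gaussian is finite. *)
Lemma sqr_normal_pdf_le (x : R) :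
  x ^+ 2 * normal_pdf 0 1 x <=
  4 * normal_peak 1 / normal_peak (Num.sqrt 2) * normal_pdf 0 (Num.sqrt 2) x.
Proof.
have s2 : Num.sqrt 2 != 0 :> R by rewrite gt_eqF // sqrtr_gt0.
rewrite !normal_pdfE ?oner_neq0 //.
set p := normal_peak _; set q := normal_peak _.
have p0 : 0 < p by apply: normal_peak_gt0; rewrite oner_neq0.
have q0 : 0 < q by apply: normal_peak_gt0.
rewrite mulrA [leRHS](_ : _ = 4 * p * normal_fun 0 (Num.sqrt 2) x); last first.
  by field; rewrite gt_eqF.
rewrite mulrCA [leRHS](_ : _ = p * (4 * normal_fun 0 (Num.sqrt 2) x)); last by ring.
apply: ler_wpM2l; first exact: ltW.
rewrite /normal_fun !subr0 sqr_sqrtr // expr1n.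
set y := x ^+ 2.
rewrite (_ : - y / (1 *+ 2) = - (y / 4) - (y / 4)); last by field.
rewrite (_ : - y / (2 *+ 2) = - (y / 4)); last by field.
rewrite expRD mulrA ler_wpM2r ?expR_ge0 //.
rewrite expRN ler_pdivrMr ?expR_gt0 //.
have := expR_ge1Dx (y / 4); lra.
Qed.

(** The positive and the negative part reduce to the nonnegative case, because the density is
    nonnegative and so passes through the maximum with 0. *)
Lemma integrable_normal_probE (m s : R) (h : R -> R) :
  (normal_prob m s).-integrable setT (EFin \o h) ->
  leb.-integrable setT (EFin \o (fun x => h x * normal_pdf m s x)) /\
  (\int[normal_prob m s]_x (h x)%:E = \int[leb]_x (h x * normal_pdf m s x)%:E)%E.
Proof.
move=> /integrableP[mh ih].
have mpdf : measurable_fun setT (EFin \o normal_pdf m s).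
  by apply/measurable_EFinP; exact: measurable_normal_pdf.
have pdf0 x : (0 <= (normal_pdf m s x)%:E)%E by rewrite lee_fin normal_pdf_ge0.
have E : EFin \o (fun x => h x * normal_pdf m s x) =
    ((EFin \o h) \* (EFin \o normal_pdf m s))%E.
  by apply/funext => x; rewrite /= EFinM.
split.
  rewrite E; apply/integrableP; split; first exact: emeasurable_funM.
  move: ih; rewrite ge0_integral_normal_prob //; last exact: measurableT_comp.
  congr (_ < _)%E; apply: eq_integral => x _.
  by rewrite abseM [in RHS](gee0_abs (pdf0 x)).
rewrite [LHS]integralE [RHS]integralE; congr (_ - _)%E.
  rewrite ge0_integral_normal_prob//; last exact: measurable_funepos.
  apply: eq_integral => x _.
  by rewrite !funeposE !EFinM /= maxe_pMl // mul0e.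
rewrite ge0_integral_normal_prob//; last exact: measurable_funeneg.
apply: eq_integral => x _.
by rewrite !funenegE -!EFinN -mulNr !EFinM /= maxe_pMl // mul0e.
Qed.

Lemma integrable_sqr_normal_prob : gam.-integrable setT (fun x : R => (x ^+ 2)%:E).
Proof.
have msqr : measurable_fun setT (fun x : R => (x ^+ 2)%:E).
  by apply/measurable_EFinP; exact: measurable_funX.
apply/integrableP; split => //.
rewrite ge0_integral_normal_prob //; last exact: measurableT_comp.
have mpdf s : measurable_fun setT (EFin \o normal_pdf (0 : R) s).
  by apply/measurable_EFinP; exact: measurable_normal_pdf.
set c := 4 * normal_peak 1 / normal_peak (Num.sqrt 2) : R.
have c0 : 0 <= c by rewrite !mulr_ge0 ?normal_peak_ge0 // invr_ge0 normal_peak_ge0.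
apply: (@le_lt_trans _ _ (\int[leb]_x (c%:E * (normal_pdf 0 (Num.sqrt 2) x)%:E))%E).
  apply: ge0_le_integral => //.
  - by move=> x _; rewrite mule_ge0// lee_fin normal_pdf_ge0.
  - by apply: emeasurable_funM; [exact: measurableT_comp|exact: mpdf].
  - by apply: emeasurable_funM; last exact: mpdf.
  - move=> x _; have x0 : (0 <= (x ^+ 2)%:E)%E by rewrite lee_fin sqr_ge0.
    rewrite (gee0_abs x0) -!EFinM lee_fin.
    exact: sqr_normal_pdf_le.
rewrite ge0_integralZl//; last 2 first.
- exact: mpdf.
- by move=> x _; rewrite lee_fin normal_pdf_ge0.
by rewrite integral_normal_pdf mule1 ltry.
Qed.

(** The fundamental theorem of calculus gives the integral over growing symmetric intervals as a
    difference of boundary values, which vanishes in the limit; dominated convergence, with [g']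
    itself as dominating function, identifies that limit with the integral over the line. *)
Lemma integral_derive_eq0 (g g' : R -> R) :
  (forall x : R, is_derive x 1 g (g' x)) -> continuous g' ->
  leb.-integrable setT (EFin \o g') ->
  g n%:R @[n --> \oo] --> (0 : R) -> g (- n%:R) @[n --> \oo] --> (0 : R) ->
  (\int[leb]_x (g' x)%:E = 0)%E.
Proof.
move=> dg cg' ig' gy gNy.
(* The bound is [n.+1] rather than [n] so that the interval is never reduced to a point. *)
pose f_ n x := ((EFin \o g') \_ `[- n.+1%:R, n.+1%:R]) x.
have mg' : measurable_fun setT (EFin \o g') by exact: measurable_int ig'.
have f_E n : (\int[leb]_x f_ n x = (g n.+1%:R - g (- n.+1%:R))%:E)%E.
  rewrite -integral_mkcond EFinB (continuous_FTC2 (F := g)) //.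
  - by rewrite (@lt_trans _ _ 0) ?oppr_lt0 ?ltr0n.
  - exact: continuous_subspaceT.
  - split => [x _| |].
    + exact: ex_derive.
    + by apply: cvg_at_right_filter; apply: differentiable_continuous; apply/derivable1_diffP.
    + by apply: cvg_at_left_filter; apply: differentiable_continuous; apply/derivable1_diffP.
  - by move=> x _; rewrite derive1E derive_val.
have [] := @dominated_convergence _ _ _ leb setT measurableT f_ (EFin \o g')
  (abse \o (EFin \o g')) _ mg'.
- by move=> n; apply/(measurable_restrictT _ _).1 => //; exact: measurable_funTS.
- apply: aeW => x _; apply: cvg_near_cst; near=> n.
  rewrite /f_ patchE ifT // inE /= in_itv /= -ler_norml.
  near: n; exists (Num.bound `|x|) => // n /= xn.
  rewrite (le_trans (ltW (archi_boundP (normr_ge0 x)))) // ler_nat.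
  exact: leq_trans xn _.
- exact: integrable_abse.
- apply: aeW => x n _; rewrite /f_ patchE; case: ifP => // _.
  by rewrite abse0 abse_ge0.
move=> _ _.
under eq_fun do rewrite f_E.
move=> H; apply: (cvg_unique _ H) => //.
apply: (@cvg_trans _ ((g n.+1%:R - g (- n.+1%:R))%:E @[n --> \oo])) => //.
apply/fine_cvgP; split; first by near=> n.
rewrite [X in _ --> X](_ : _ = 0 - 0); last by rewrite subr0.
apply: cvgB; first by move: gy; rewrite -(cvg_shiftS (fun n : nat => g n%:R)).
by move: gNy; rewrite -(cvg_shiftS (fun n : nat => g (- n%:R))).
Unshelve. all: by end_near.
Qed.

Implicit Types (f g : R -> R) (x : R).

Lemma is_derive1M f g x (df dg : R) :
  is_derive x 1 f df -> is_derive x 1 g dg ->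
  is_derive x 1 (fun y => f y * g y) (f x * dg + g x * df).
Proof. by move=> ? ?; exact: is_deriveM. Qed.

Lemma is_derive1_affine (a b x : R) : is_derive x 1 (fun y => a * y + b) a.
Proof.
have -> : (fun y => a * y + b) = (a \*: id) + cst b :> (R -> R) by [].
by apply: is_derive_eq; rewrite addr0 /GRing.scale /= mulr1.
Qed.

Lemma is_derive1_expR f x (df : R) :
  is_derive x 1 f df -> is_derive x 1 (fun y => expR (f y)) (df * expR (f x)).
Proof.
move=> dfx; rewrite mulrC.
exact: (is_derive1_comp (is_derive_expR (f x)) dfx).
Qed.

Lemma is_derive_normal_pdf x :
  is_derive x 1 (normal_pdf 0 1) (- x * normal_pdf 0 1 x).
Proof.
rewrite normal_pdfE ?oner_neq0 //.
have dq : is_derive x 1 (fun y : R => - (y - 0) ^+ 2 / (1 ^+ 2 *+ 2)) (- x).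
  have -> : (fun y : R => - (y - 0) ^+ 2 / (1 ^+ 2 *+ 2)) =
      (fun y => (- 2^-1 * y + 0) * (1 * y + 0)).
    by apply/funext => y; field.
  apply: (is_derive_eq (is_derive1M (is_derive1_affine _ _ x) (is_derive1_affine _ _ x))).
  by field.
apply: (is_derive_eq (is_derive1M (is_derive_cst (normal_peak 1) x 1) (is_derive1_expR dq))).
rewrite /= /normal_fun; ring.
Qed.

Lemma normal_pdf_cvg0 : normal_pdf 0 1 n%:R @[n --> \oo] --> (0 : R).
Proof.
rewrite normal_pdfE ?oner_neq0 //.
rewrite /normal_fun; set c := normal_peak 1.
have c0 : 0 <= c by exact: normal_peak_ge0.
(* The comparison with the harmonic sequence comes from exp (n^2 / 2) >= 1 + n^2 / 2 >= (n + 1) /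
   2. *)
apply: (@squeeze_cvgr _ _ _ _ (cst 0) (fun n => 2 * c * n.+1%:R^-1)); last 2 first.
- exact: cvg_cst.
- rewrite -[X in _ --> X](mulr0 (2 * c)); apply: cvgM; first exact: cvg_cst.
  exact: cvg_harmonic.
apply: nearW => n; rewrite mulr_ge0 ?expR_ge0 //= subr0 expr1n.
rewrite (mulrC 2) -mulrA ler_wpM2l // mulNr expRN -[leRHS]invrK lef_pV2.
- rewrite (le_trans _ (expR_ge1Dx _))// invfM invrK -(natr1 n).
  set y : R := n%:R; have := sqr_ge0 (y - 1); nra.
- by rewrite posrE expR_gt0.
- by rewrite posrE invr_gt0 mulr_gt0 // invr_gt0 ltr0n.
Qed.

(** The quadratic bound serves both integrands of the integration by parts, the bounded [F'] and
    [x * F x], the latter through |x| <= 1 + x^2. *)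
Lemma gaussian_integrable_linear_growth (C : R) (F : R -> R) :
  measurable_fun setT F -> (forall x, `|F x| <= C * (1 + x ^+ 2)) ->
  gam.-integrable setT (EFin \o F).
Proof.
move=> mF bF.
apply: (@le_integrable _ _ _ gam setT measurableT (EFin \o F)
  (EFin \o (fun x => C * (1 + x ^+ 2)))).
- exact/measurable_EFinP.
- by move=> x _; rewrite /= lee_fin (le_trans (bF x))// ler_norm.
- apply: integrableZl_EFin; apply: integrableD_EFin.
    exact: integrable_cst_EFin.
  exact: integrable_sqr_normal_prob.
Qed.

Lemma bounded_mul_cvg0 (M : R) (u v : nat -> R) : (forall k, `|u k| <= M) ->
  v n @[n --> \oo] --> (0 : R) -> u n * v n @[n --> \oo] --> (0 : R).
Proof.
move=> bu v0; apply/norm_cvg0P.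
apply: (@squeeze_cvgr _ _ _ _ (cst 0) (fun n => M * `|v n|)).
- by apply: nearW => k; rewrite normr_ge0 normrM ler_wpM2r.
- exact: cvg_cst.
- rewrite -[X in _ --> X](mulr0 M); apply: cvgM; first exact: cvg_cst.
  by rewrite -(normr0 R); apply: cvg_norm.
Qed.

(** Since the density has derivative - x times itself, (x F - F') times the density is the
    derivative of - F times the density, which vanishes at both ends because [F] is bounded. *)
Lemma gaussian_integration_by_parts (M : R) (F F' : R -> R) :
  (forall x : R, is_derive x 1 F (F' x)) -> continuous F' ->
  (forall x, `|F x| <= M) -> (forall x, `|F' x| <= M) ->
  \int[gam]_x (x * F x) = \int[gam]_x F' x.
Proof.
move=> dF cF' bF bF'.
have cF : continuous F.
  by move=> x; apply: differentiable_continuous; apply/derivable1_diffP.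
have mF : measurable_fun setT F by exact: continuous_measurable_fun.
have mF' : measurable_fun setT F' by exact: continuous_measurable_fun.
have M0 : 0 <= M by exact: le_trans (bF 0).
have iF' : gam.-integrable setT (EFin \o F').
  apply: (gaussian_integrable_linear_growth (C := M)) => // x.
  by rewrite (le_trans (bF' x))// ler_peMr// lerDl sqr_ge0.
have ixF : gam.-integrable setT (EFin \o (fun x => x * F x)).
  apply: (gaussian_integrable_linear_growth (C := M)) => //.
    exact: measurable_funM.
  move=> x; rewrite normrM mulrC ler_pM//.
  have := sqr_ge0 (`|x| - 1); have := real_normK (num_real x); nra.
apply/eqP; rewrite -subr_eq0 -RintegralB//; apply/eqP.
have iG : gam.-integrable setT (EFin \o (fun x => x * F x - F' x)).
  exact: integrableB_EFin.
have [iGp iGE] := integrable_normal_probE iG; rewrite /Rintegral iGE.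
have dG (x : R) : is_derive x 1 (fun y => - F y * normal_pdf 0 1 y)
    ((x * F x - F' x) * normal_pdf 0 1 x).
  have dNF : is_derive x 1 (fun y => - F y) (- F' x) by exact: is_deriveN.
  apply: (is_derive_eq (is_derive1M dNF (is_derive_normal_pdf x))).
  by ring.
rewrite (integral_derive_eq0 dG) //.
- move=> x; apply: cvgM; last by apply: continuous_normal_pdf; rewrite oner_neq0.
  apply: cvgB; last exact: cF'.
  apply: cvgM; [exact: cvg_id|exact: cF].
- apply: (bounded_mul_cvg0 (M := M)); last exact: normal_pdf_cvg0.
  by move=> k; rewrite normrN.
(* The density is even, so the limit at minus infinity follows from the one at plus infinity. *)
- have -> : (fun k : nat => - F (- k%:R) * normal_pdf 0 1 (- k%:R)) =
      (fun k : nat => - F (- k%:R) * normal_pdf 0 1 k%:R).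
    apply/funext => k; congr (_ * _); rewrite !normal_pdfE ?oner_neq0 //.
    by rewrite /normal_fun !subr0 sqrrN.
  apply: (bounded_mul_cvg0 (M := M)); last exact: normal_pdf_cvg0.
  by move=> k; rewrite normrN.
Qed.

End gaussian.

(** * Product structure of the joint law *)

Section coordinate_space.
Context {R : realType} (I : finType).

Definition box (A : I -> set R) : set (I -> R) := [set v | forall a, A a (v a)].

Definition boxes : set (set (I -> R)) :=
  [set box A | A in [set A | forall a, measurable (A a)]].

(** The product sigma-algebra on functions from [I] to the reals. Generated by boxes, it comes with
    a class stable under intersection on which independence gives the joint law explicitly. *)
Definition vec := g_sigma_algebraType boxes.

Definition upd (a : I) (x : R) (v : vec) : vec :=
  fun b => if b == a then x else v b.

Lemma setI_closed_boxes : setI_closed boxes.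
Proof.
move=> _ _ [A mA <-] [B mB <-]; exists (fun a => A a `&` B a).
  by move=> a; exact: measurableI.
apply/seteqP; split => v /=; first by move=> h; split => a; have [] := h a.
by move=> [hA hB] a; split.
Qed.

Lemma boxesT : boxes setT.
Proof. by exists (fun=> setT) => //; apply/seteqP; split. Qed.

Lemma measurable_box (A : I -> set R) :
  (forall a, measurable (A a)) -> measurable (box A : set vec).
Proof. by move=> mA; apply: sub_sigma_algebra; exists A. Qed.

Lemma measurable_coord (a : I) : measurable_fun setT (fun v : vec => v a).
Proof.
move=> _ B mB; rewrite setTI.
have -> : (fun v : vec => v a) @^-1` B = box (fun b => if b == a then B else setT).
  apply/seteqP; split => v /=.
    by move=> Bv b; case: eqP => // ->.
  by move=> /(_ a); rewrite eqxx.
by apply: measurable_box => b; case: eqP.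
Qed.

Lemma measurable_fun_vec d (T : measurableType d) (F : T -> vec) :
  (forall a, measurable_fun setT (fun t => F t a)) -> measurable_fun setT F.
Proof.
move=> mF; apply: (@measurability _ _ T vec setT F boxes) => // _ [_ [A mA <-] <-].
rewrite setTI.
have -> : F @^-1` box A = \bigcap_(a in [set: I]) ((fun t => F t a) @^-1` A a).
  by apply/seteqP; split => t /= h a => [_|]; exact: h.
apply: fin_bigcap_measurable; first exact: finite_finset.
by move=> a _; rewrite -[X in measurable X]setTI; exact: mF.
Qed.

Lemma measurable_upd (a : I) :
  measurable_fun setT (fun z : measurableTypeR R * vec => upd a z.1 z.2).
Proof.
apply: measurable_fun_vec => b; rewrite /upd; case: eqP => _.
  exact: measurable_fst.
exact: (measurableT_comp (measurable_coord b) measurable_snd).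
Qed.

Lemma measurable_updl (a : I) (v : vec) : measurable_fun setT (fun x : R => upd a x v).
Proof.
apply: measurable_fun_vec => b; rewrite /upd; case: eqP => _.
  exact: measurable_id.
exact: measurable_cst.
Qed.

Lemma upd_id (a : I) (v : vec) : upd a (v a) v = v.
Proof. by apply/funext => b; rewrite /upd; case: eqP => [->|]. Qed.

Lemma upd_upd (a : I) (x y : R) (v : vec) : upd a x (upd a y v) = upd a x v.
Proof. by apply/funext => b; rewrite /upd; case: eqP. Qed.

Lemma upd_comm (a b : I) (x y : R) (v : vec) : a != b ->
  upd a x (upd b y v) = upd b y (upd a x v).
Proof.
move=> ab; apply/funext => c; rewrite /upd; case: eqP => // ->.
by rewrite (negbTE ab).
Qed.

(** Boxes form a generating class stable under intersection and contain the whole space, so they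
    determine a probability. *)
Lemma vec_measure_unique (m1 m2 : probability vec R) :
  (forall A, (forall a, measurable (A a)) -> m1 (box A) = m2 (box A)) ->
  forall B : set vec, measurable B -> m1 B = m2 B.
Proof.
move=> h B mB.
apply: (@measure_unique _ R vec boxes (fun=> setT)) => //.
- exact: setI_closed_boxes.
- by move=> _; exact: boxesT.
- by rewrite bigcup_const.
- by move=> _ [A mA <-]; exact: h.
- by move=> _; rewrite (@le_lt_trans _ _ 1%E) ?probability_le1 ?ltry.
Qed.

End coordinate_space.

Arguments vec R I : clear implicits.
Arguments upd {R I}.

Section resampling_def.
Context {R : realType} {I : finType}.
Local Notation gam := (normal_prob (0 : R) 1).

(** Drawing the coordinate [a] afresh from the standard Gaussian, independently of everything else,
    does not change the law. All later uses of independence and of the Gaussian distribution go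
    through this property. *)
Definition resampling_invariant (mu : probability (vec R I) R) : Prop :=
  forall (a : I) (B : set (vec R I)), measurable B ->
    mu B = pushforward (gam \x mu)%E (fun z : measurableTypeR R * vec R I => upd a z.1 z.2) B.

End resampling_def.

Section gaussian_law.
Context {R : realType} {I : finType} d (T : measurableType d) (P : probability T R).
Variables (g : I -> {RV P >-> R}).
Local Notation gam := (normal_prob (0 : R) 1).

Definition joint (w : T) : vec R I := fun a => g a w.

Lemma measurable_joint : measurable_fun setT joint.
Proof. by apply: measurable_fun_vec => a; exact: measurable_funPT. Qed.

HB.instance Definition _ := isMeasurableFun.Build _ _ _ _ joint measurable_joint.

Definition joint_law : probability (vec R I) R := distribution P joint.

Hypothesis g_iid : iid_standard_gaussian g.

Lemma joint_law_box (A : I -> set R) : (forall a, measurable (A a)) ->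
  (joint_law (box A) = \prod_a gam (A a))%E.
Proof.
move=> mA; have [ind gau] := g_iid.
transitivity (P (\bigcap_(i in [set` [set: I]%SET]) (g i @^-1` A i))).
  congr (P _); apply/seteqP; split => w /= h a; first by move=> _; exact: h.
  by apply: h; rewrite /= inE.
rewrite ind //; apply: eq_big => [a|a _]; first by rewrite inE.
by rewrite -(gau a _ (mA a)).
Qed.

(** It is enough to compare both laws on boxes, where each is the product of the Gaussian masses of
    the sides. *)
Lemma joint_law_resampling : resampling_invariant joint_law.
Proof.
move=> a.
pose u := fun z : measurableTypeR R * vec R I => upd a z.1 z.2.
have mu : measurable_fun setT u by exact: measurable_upd.
pose um : {mfun (measurableTypeR R * vec R I)%type >-> vec R I} :=
  HB.pack u (isMeasurableFun.Build _ _ _ _ _ mu).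
pose m2 : probability (vec R I) R := distribution (gam \x joint_law)%E um.
apply: (vec_measure_unique (m1 := joint_law) (m2 := m2)) => A mA.
(* As [upd a] overwrites the coordinate [a], the side [A a] constrains the fresh Gaussian only and
   becomes free for the old vector. *)
pose A' b := if b == a then setT else A b.
have mA' b : measurable (A' b) by rewrite /A'; case: eqP.
transitivity ((gam \x joint_law)%E (A a `*` box A')).
  rewrite product_measure1E; [|exact: mA|exact: measurable_box].
  transitivity (gam (A a) * joint_law (box A'))%E; last by [].
  rewrite (joint_law_box mA) (joint_law_box mA').
  rewrite (bigD1 a) //= [in RHS](bigD1 a) //= {1}/A' eqxx (probability_setT gam) mul1e.
  by congr (_ * _)%E; apply: eq_bigr => b /negbTE ba; rewrite /A' ba.
congr (product_measure1 _ _ _); apply/seteqP; split => -[x v] /=.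
  move=> [Ax hv] b; rewrite /u /upd /=; case: eqP => [->//|/eqP ba].
  by have := hv b; rewrite /A' (negbTE ba).
move=> h; split; first by have := h a; rewrite /u /upd /= eqxx.
move=> b; rewrite /A'; case: eqP => // /eqP ba.
by have := h b; rewrite /u /upd /= (negbTE ba).
Qed.

End gaussian_law.

(** * Variance bound and integration by parts *)

Section square_integrable.
Context {d} {T : measurableType d} {R : realType} (P : probability T R).
Implicit Types f g : T -> R.

Definition sqr_integrable f :=
  measurable_fun setT f /\ P.-integrable setT (EFin \o (fun x => f x ^+ 2)).

Lemma sqr_integrable_integrable f : sqr_integrable f -> P.-integrable setT (EFin \o f).
Proof.
move=> [mf f2]; apply: (@le_integrable_EFin _ _ _ P f (fun x => 1 + f x ^+ 2)) => //.
  by move=> x; rewrite -(real_normK (num_real (f x))); have := sqr_ge0 (`|f x| - 1); nra.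
by apply: integrableD_EFin => //; exact: integrable_cst_EFin.
Qed.

Lemma le_sqr_integrable f g : measurable_fun setT f -> (forall x, `|f x| <= g x) ->
  sqr_integrable g -> sqr_integrable f.
Proof.
move=> mf fg [mg g2]; split => //.
apply: (le_integrable_EFin _ _ g2); first exact: measurable_funX.
by move=> x; rewrite normrX; have := fg x; have := normr_ge0 (f x); nra.
Qed.

Lemma sqr_integrableD f g : sqr_integrable f -> sqr_integrable g ->
  sqr_integrable (fun x => f x + g x).
Proof.
move=> [mf f2] [mg g2]; split; first exact: measurable_funD.
apply: (@le_integrable_EFin _ _ _ P _ (fun x => 2 * f x ^+ 2 + 2 * g x ^+ 2)).
- by apply: measurable_funX; exact: measurable_funD.
- by move=> x; rewrite ger0_norm ?sqr_ge0 //; have := sqr_ge0 (f x - g x); nra.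
- by apply: integrableD_EFin; exact: integrableZl_EFin.
Qed.

Lemma sqr_integrableZ (k : R) f : sqr_integrable f -> sqr_integrable (fun x => k * f x).
Proof.
move=> [mf f2]; split; first exact: measurable_funM.
have -> : (fun x => (k * f x) ^+ 2) = (fun x => k ^+ 2 * f x ^+ 2).
  by apply/funext => x; rewrite exprMn.
exact: integrableZl_EFin.
Qed.

Lemma sqr_integrable_cst (k : R) : sqr_integrable (fun=> k).
Proof. by split => //; exact: integrable_cst_EFin. Qed.

Lemma sqr_integrable_sum (I : Type) (s : seq I) (h : I -> T -> R) :
  (forall i, sqr_integrable (h i)) -> sqr_integrable (fun x => \sum_(i <- s) h i x).
Proof.
move=> hi; elim: s => [|i s IH].
  under eq_fun do rewrite big_nil; exact: sqr_integrable_cst.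
by under eq_fun do rewrite big_cons; exact: sqr_integrableD.
Qed.

End square_integrable.

Section gaussian_variance.
Context {R : realType}.
Local Notation gam := (normal_prob (0 : R) 1).

(* Its value is 1, but only its finiteness matters. *)
Definition gaussian_sqr_moment : R := \int[gam]_x (x ^+ 2).

Lemma gaussian_sqr_moment_ge0 : 0 <= gaussian_sqr_moment.
Proof. by apply: Rintegral_ge0 => x _; rewrite sqr_ge0. Qed.

Lemma gaussian_sqr_integrable_lip (c : R) (phi : R -> R) : measurable_fun setT phi ->
  (forall x y, `|phi x - phi y| <= c * `|x - y|) -> sqr_integrable gam phi.
Proof.
move=> mphi lip.
apply: (@le_sqr_integrable _ _ _ gam _ (fun x => `|phi 0| + c * `|x|)) => //.
  move=> x; have := lip x 0; rewrite subr0.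
  by have := ler_normD (phi 0) (phi x - phi 0); rewrite subrKC; lra.
apply: sqr_integrableD; first exact: sqr_integrable_cst.
apply: sqr_integrableZ; split; first exact: (@normr_measurable R setT).
have -> : (fun x : R => `|x| ^+ 2) = (fun x => x ^+ 2).
  by apply/funext => x; rewrite real_normK ?num_real.
exact: integrable_sqr_normal_prob.
Qed.

(* The variance is at most the mean square distance to [phi 0]. *)
Lemma gaussian_variance_lip (c : R) (phi : R -> R) : measurable_fun setT phi ->
  (forall x y, `|phi x - phi y| <= c * `|x - y|) ->
  \int[gam]_x (phi x ^+ 2) <= (\int[gam]_x phi x) ^+ 2 + gaussian_sqr_moment * c ^+ 2.
Proof.
move=> mphi lip; have sphi := gaussian_sqr_integrable_lip mphi lip.
have [_ iphi2] := sphi; have iphi := sqr_integrable_integrable sphi.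
set m := \int[gam]_x phi x; set p0 := phi 0.
have E : \int[gam]_x (phi x ^+ 2) =
    \int[gam]_x ((phi x - p0) ^+ 2) + (2 * p0 * m - p0 ^+ 2).
  have -> : 2 * p0 * m - p0 ^+ 2 = \int[gam]_x (2 * p0 * phi x - p0 ^+ 2).
    rewrite RintegralB //; last 2 first.
    - exact: integrableZl_EFin.
    - exact: integrable_cst_EFin.
    by rewrite RintegralZl // Rintegral_probability_cst.
  rewrite -RintegralD //; last 2 first.
  - have -> : (fun x => (phi x - p0) ^+ 2) =
        (fun x => phi x ^+ 2 - (2 * p0 * phi x - p0 ^+ 2)).
      by apply/funext => x; ring.
    apply: integrableB_EFin => //; apply: integrableB_EFin.
      exact: integrableZl_EFin.
    exact: integrable_cst_EFin.
  - apply: integrableB_EFin; first exact: integrableZl_EFin.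
    exact: integrable_cst_EFin.
  by apply: eq_Rintegral => x _; ring.
have le1 : \int[gam]_x ((phi x - p0) ^+ 2) <= gaussian_sqr_moment * c ^+ 2.
  have ix2 := @integrable_sqr_normal_prob R.
  have sqb x : (phi x - p0) ^+ 2 <= c ^+ 2 * x ^+ 2.
    rewrite -(real_normK (num_real (phi x - p0))) -(real_normK (num_real x)).
    have := lip x 0; rewrite subr0 -/p0 -exprMn => h.
    by rewrite lerXn2r // nnegrE // (le_trans _ h).
  rewrite mulrC -RintegralZl //; apply: le_Rintegral => //.
  - apply: (@le_integrable_EFin _ _ _ gam _ (fun x => c ^+ 2 * x ^+ 2)).
    + by apply: measurable_funX; exact: measurable_funB.
    + by move=> x; rewrite ger0_norm ?sqr_ge0.
    + exact: integrableZl_EFin.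
  - exact: integrableZl_EFin.
rewrite E; have := sqr_ge0 (m - p0); nra.
Qed.

End gaussian_variance.

(** * Averaging over one coordinate at a time, and tensorization of the variance *)

Section resampling.
Context {R : realType} {I : finType} (mu : probability (vec R I) R).
Hypothesis mu_resampling : resampling_invariant mu.
Local Notation gam := (normal_prob (0 : R) 1).
Implicit Types (F G : vec R I -> R) (v : vec R I) (a b : I).

(** For a resampling-invariant law this is the conditional expectation of [F] given the coordinates
    other than [a]. *)
Definition avg (a : I) (F : vec R I -> R) (v : vec R I) : R :=
  \int[gam]_x F (upd a x v).

Lemma ge0_integral_resampling (a : I) (F : vec R I -> \bar R) :
  measurable_fun setT F -> (forall v, 0 <= F v)%E ->
  (\int[mu]_v F v = \int[mu]_v \int[gam]_x F (upd a x v))%E.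
Proof.
move=> mF F0; have mupd := @measurable_upd R I a.
rewrite (eq_measure_integral (pushforward (gam \x mu)%E
  (fun z : measurableTypeR R * vec R I => upd a z.1 z.2))); last first.
  by move=> B mB _; exact: mu_resampling.
rewrite (ge0_integral_pushforward mupd) //.
have mFu := measurableT_comp mF mupd.
by rewrite preimage_setT (fubini_tonelli2 _ mFu) // => z; exact: F0.
Qed.

Lemma integrable_resampling (a : I) F :
  mu.-integrable setT (EFin \o F) ->
  (gam \x mu)%E.-integrable setT
    (EFin \o (fun z : measurableTypeR R * vec R I => F (upd a z.1 z.2))).
Proof.
move=> iF; have mF : measurable_fun setT (EFin \o F) by exact: measurable_int iF.
have mFu : measurable_fun setT
    (EFin \o (fun z : measurableTypeR R * vec R I => F (upd a z.1 z.2))).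
  exact: (measurableT_comp mF (measurable_upd a)).
apply/(integrable21ltyP _ _ mFu).
move/integrableP : iF => [_].
by rewrite (ge0_integral_resampling a) //; exact: measurableT_comp.
Qed.

(** Integrability is asked of every section, not of almost every one: the real-valued [avg a F] then
    equals the extended partial integral of Fubini's theorem at each point. *)
Lemma integral_resampling (a : I) F :
  mu.-integrable setT (EFin \o F) ->
  (forall v, gam.-integrable setT (EFin \o (fun x => F (upd a x v)))) ->
  mu.-integrable setT (EFin \o avg a F) /\ \int[mu]_v F v = \int[mu]_v avg a F v.
Proof.
move=> iF iFv; have mF : measurable_fun setT (EFin \o F) by exact: measurable_int iF.
have iFu := integrable_resampling a iF.
have avgE : EFin \o avg a F = fubini_G gam
    (EFin \o (fun z : measurableTypeR R * vec R I => F (upd a z.1 z.2))).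
  apply/funext => v; rewrite /= /avg /Rintegral fineK //.
  exact: integrable_fin_num (iFv v).
have mupd := @measurable_upd R I a.
have mabs : measurable_fun setT
    (fun z : measurableTypeR R * vec R I => `|(EFin \o F) (upd a z.1 z.2)|%E).
  by apply: measurableT_comp => //; exact: (measurableT_comp mF mupd).
split.
  rewrite avgE; apply/integrableP; split; first exact: measurable_fubini_G iFu.
  have /integrableP[_] := iF.
  rewrite (ge0_integral_resampling a) //; last exact: measurableT_comp.
  apply: le_lt_trans; apply: ge0_le_integral => //.
  - apply: measurableT_comp => //; exact: measurable_fubini_G iFu.
  - exact: (measurable_fun_fubini_tonelli_G (m1 := gam) _ mabs).
  - move=> v _; apply: le_abse_integral => //.
    exact: (measurableT_comp mF (measurable_updl a v)).
congr fine; rewrite (_ : (fun v => (avg a F v)%:E) = EFin \o avg a F) // avgE.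
rewrite integral21_prod_meas1 //.
rewrite (eq_measure_integral (pushforward (gam \x mu)%E
  (fun z : measurableTypeR R * vec R I => upd a z.1 z.2))); last first.
  by move=> B mB _; exact: mu_resampling.
rewrite (integral_pushforward mupd) ?preimage_setT //.
Qed.

Definition coord_lip (c : I -> R) F :=
  forall a x y v, `|F (upd a x v) - F (upd a y v)| <= c a * `|x - y|.

(** Resampling the coordinate [a] turns its second moment into that of the standard Gaussian. *)
Lemma coord_sqr_integrable (a : I) : sqr_integrable mu (fun v => v a).
Proof.
have m2 : measurable_fun setT (fun v : vec R I => (v a ^+ 2)%:E).
  by apply/measurable_EFinP; apply: measurable_funX; exact: measurable_coord.
split; first exact: measurable_coord.
apply/integrableP; split => //.
rewrite (ge0_integral_resampling a) //; last exact: measurableT_comp.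
have /integrableP[_ ix2] := @integrable_sqr_normal_prob R.
under eq_integral => v _.
  under eq_integral => x _ do rewrite /= /upd eqxx.
  over.
by rewrite integral_cst // [X in (_ * X)%E](probability_setT mu) mule1.
Qed.

(** Intermediate points between the zero vector, which is [cutoff v [::]] for every [v], and [v]
    itself; consecutive ones differ in a single coordinate, which allows induction on the list. *)
Definition cutoff (v : vec R I) (s : seq I) : vec R I := fun a => if a \in s then v a else 0.

Lemma cutoff_cons v a s : cutoff v (a :: s) = upd a (v a) (cutoff v s).
Proof.
by apply/funext => b; rewrite /cutoff /upd in_cons; case: eqP => [->|].
Qed.

Lemma cutoff_enum v : cutoff v (enum I) = v.
Proof. by apply/funext => a; rewrite /cutoff mem_enum. Qed.

(** Restoring the coordinates of [v] one at a time from the zero vector costs at most [c a * |v a|]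
    for each. *)
Lemma coord_lip_growth c F v : coord_lip c F ->
  `|F v| <= `|F (cutoff v [::])| + \sum_a c a * `|v a|.
Proof.
move=> lip; rewrite -{1}(cutoff_enum v) big_enum_val.
rewrite -(big_enum_val (fun a => c a * `|v a|)) -big_enum /=.
elim: (enum I) (enum_uniq I) => [|a s IH] /=; first by rewrite big_nil addr0.
move=> /andP[as_ us]; rewrite big_cons cutoff_cons.
have := IH us; have := lip a (v a) (cutoff v s a) (cutoff v s).
(* The list has no repetition, so the coordinate about to be restored still has the default value
   0. *)
have m0 : cutoff v s a = 0 by rewrite /cutoff (negbTE as_).
rewrite upd_id m0 subr0.
have := ler_normD (F (cutoff v s)) (F (upd a (v a) (cutoff v s)) - F (cutoff v s)).
rewrite subrKC; lra.
Qed.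

Lemma coord_lip_sqr_integrable c F : measurable_fun setT F -> coord_lip c F ->
  sqr_integrable mu F.
Proof.
move=> mF lip.
apply: (@le_sqr_integrable _ _ _ mu _
  (fun v => `|F (cutoff (fun=> 0) [::])| + \sum_a c a * `|v a|)) => //.
  by move=> v; exact: coord_lip_growth.
apply: (@sqr_integrableD _ _ _ mu (fun=> `|F (cutoff (fun=> 0) [::])|)).
  exact: sqr_integrable_cst.
apply: sqr_integrable_sum => a; apply: sqr_integrableZ.
have [ma i2] := coord_sqr_integrable a; split; first exact: measurableT_comp.
have -> : (fun v : vec R I => `|v a| ^+ 2) = (fun v => v a ^+ 2).
  by apply/funext => v; rewrite real_normK ?num_real.
exact: i2.
Qed.

Lemma coord_lip_updl c F a v : measurable_fun setT F -> coord_lip c F ->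
  sqr_integrable gam (fun x => F (upd a x v)).
Proof.
move=> mF lip; apply: (@gaussian_sqr_integrable_lip R (c a)) => //.
exact: (measurableT_comp mF (measurable_updl a v)).
Qed.

(** The constants survive averaging: [avg a F] no longer depends on the coordinate [a], and updates
    of another coordinate commute with that of [a], so their Lipschitz bound can be integrated. *)
Lemma coord_lip_avg c F a : measurable_fun setT F -> coord_lip c F ->
  measurable_fun setT (avg a F) /\ coord_lip c (avg a F).
Proof.
move=> mF lip.
have iFv b v := sqr_integrable_integrable (coord_lip_updl b v mF lip).
have iF := sqr_integrable_integrable (coord_lip_sqr_integrable mF lip).
have [iavg _] := integral_resampling iF (iFv a); split.
  by apply/measurable_EFinP; exact: measurable_int iavg.
move=> b x y v; rewrite /avg; have [->|ab] := eqVneq a b.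
  under eq_Rintegral => z _ do rewrite upd_upd.
  under [X in _ - X]eq_Rintegral => z _ do rewrite upd_upd.
  (* No sign is assumed for [c]; the Lipschitz bound itself shows that the right-hand side is
     nonnegative. *)
  rewrite subrr normr0; apply: le_trans (lip b x y v); exact: normr_ge0.
rewrite -RintegralB //.
apply: (le_trans (le_normr_Rintegral _ _)) => //; first exact: integrableB_EFin.
rewrite -[leRHS](Rintegral_probability_cst gam).
apply: le_Rintegral => //.
- by apply: integrable_norm_EFin; exact: integrableB_EFin.
- exact: integrable_cst_EFin.
- by move=> z _; rewrite !(upd_comm _ _ _ ab).
Qed.

(** One step of the tensorization: with the other coordinates frozen, the one-dimensional variance
    bound applies to [F] as a function of the coordinate [a], and it is then integrated over
    them. *)
Lemma sqr_mean_avg c F a : measurable_fun setT F -> coord_lip c F ->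
  \int[mu]_v (F v ^+ 2) <=
    \int[mu]_v (avg a F v ^+ 2) + gaussian_sqr_moment * c a ^+ 2 /\
  \int[mu]_v F v = \int[mu]_v avg a F v.
Proof.
move=> mF lip.
have [_ iF2] := coord_lip_sqr_integrable mF lip.
have iF := sqr_integrable_integrable (coord_lip_sqr_integrable mF lip).
have iFv v := sqr_integrable_integrable (coord_lip_updl a v mF lip).
have [_ EF] := integral_resampling iF iFv; split => //.
have iF2v v : gam.-integrable setT (EFin \o (fun x => F (upd a x v) ^+ 2)).
  by have [] := coord_lip_updl a v mF lip.
have [iavg ->] := integral_resampling iF2 iF2v.
have [mavg lavg] := coord_lip_avg a mF lip.
have [_ iavg2] := coord_lip_sqr_integrable mavg lavg.
rewrite -[X in _ + X](Rintegral_probability_cst mu) -RintegralD //; last first.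
  exact: integrable_cst_EFin.
apply: le_Rintegral => //.
  by apply: integrableD_EFin => //; exact: integrable_cst_EFin.
move=> v _; apply: gaussian_variance_lip => //.
exact: (measurableT_comp mF (measurable_updl a v)).
Qed.

Definition avgs (s : seq I) F := foldr avg F s.

Lemma avgs_coord_lip c F s : measurable_fun setT F -> coord_lip c F ->
  measurable_fun setT (avgs s F) /\ coord_lip c (avgs s F).
Proof. by move=> mF lip; elim: s => //= a s [? ?]; exact: coord_lip_avg. Qed.

Lemma sqr_mean_avgs c F s : measurable_fun setT F -> coord_lip c F ->
  \int[mu]_v (F v ^+ 2) <=
    \int[mu]_v (avgs s F v ^+ 2) + gaussian_sqr_moment * \sum_(a <- s) c a ^+ 2 /\
  \int[mu]_v F v = \int[mu]_v avgs s F v.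
Proof.
move=> mF lip; elim: s => [|a s [IH1 IH2]] /=.
  by rewrite big_nil mulr0 addr0.
have [m1 l1] := avgs_coord_lip s mF lip.
have [S1 S2] := sqr_mean_avg a m1 l1; split; last by rewrite IH2.
by rewrite big_cons mulrDr addrA; lra.
Qed.

(** Once [a] has been averaged out its value is irrelevant, and averaging over further coordinates
    preserves this because updates of distinct coordinates commute. *)
Lemma avgs_upd s F a x v : a \in s -> avgs s F (upd a x v) = avgs s F v.
Proof.
elim: s v x => //= b s IH v x; rewrite in_cons /avg => /orP[/eqP->|as_].
  by under eq_Rintegral => z _ do rewrite upd_upd.
have [->|ba] := eqVneq b a.
  by under eq_Rintegral => z _ do rewrite upd_upd.
by under eq_Rintegral => z _ do rewrite upd_comm // IH //.
Qed.

Lemma avgs_enum F v w : avgs (enum I) F v = avgs (enum I) F w.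
Proof.
suff h s u : avgs (enum I) F (cutoff u s) = avgs (enum I) F (cutoff u [::]).
  by rewrite -(cutoff_enum v) -(cutoff_enum w) !h.
by elim: s => // a s IH; rewrite cutoff_cons avgs_upd // mem_enum.
Qed.

(** Averaging over all coordinates leaves a constant, which must be the mean, while each average
    lowers the second moment by at most [gaussian_sqr_moment * c a ^+ 2]. The variance is thus at
    most the sum of the one-coordinate contributions. *)
Lemma coord_lip_variance c F : measurable_fun setT F -> coord_lip c F ->
  \int[mu]_v ((F v - \int[mu]_w F w) ^+ 2) <= gaussian_sqr_moment * \sum_a c a ^+ 2.
Proof.
move=> mF lip; set m := \int[mu]_w F w.
have sF := coord_lip_sqr_integrable mF lip.
have [_ iF2] := sF; have iF := sqr_integrable_integrable sF.
have [S1 S2] := sqr_mean_avgs (enum I) mF lip.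
have avgE : avgs (enum I) F = fun=> m.
  rewrite /m S2; apply/funext => v.
  under eq_Rintegral => w _ do rewrite (avgs_enum F w v).
  by rewrite Rintegral_probability_cst.
move: S1; rewrite avgE Rintegral_probability_cst big_enum /= => S1.
have -> : \int[mu]_v ((F v - m) ^+ 2) = \int[mu]_v (F v ^+ 2) - m ^+ 2.
  transitivity (\int[mu]_v (F v ^+ 2 - (2 * m * F v - m ^+ 2))).
    by apply: eq_Rintegral => v _; ring.
  rewrite RintegralB //; last first.
    by apply: integrableB_EFin; [exact: integrableZl_EFin|exact: integrable_cst_EFin].
  rewrite RintegralB //; last 2 first.
  - exact: integrableZl_EFin.
  - exact: integrable_cst_EFin.
  by rewrite RintegralZl // Rintegral_probability_cst -/m; ring.
by rewrite lerBlDl.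
Qed.

(** Averaging over the coordinate [a] on both sides reduces the claim to the one-dimensional
    integration by parts with the other coordinates frozen. *)
Lemma integral_coord_mul (M : R) (a : I) (F F' : vec R I -> R) :
  measurable_fun setT F -> measurable_fun setT F' ->
  (forall v, `|F v| <= M) -> (forall v, `|F' v| <= M) ->
  (forall v (x : R), is_derive x 1 (fun y => F (upd a y v)) (F' (upd a x v))) ->
  (forall v, continuous (fun x => F' (upd a x v))) ->
  \int[mu]_v (v a * F v) = \int[mu]_v F' v.
Proof.
move=> mF mF' bF bF' dF cF'.
have mFv v := measurableT_comp mF (measurable_updl a v).
have icoord := sqr_integrable_integrable (coord_sqr_integrable a).
have ixF : mu.-integrable setT (EFin \o (fun v => v a * F v)).
  apply: (@le_integrable_EFin _ _ _ mu _ (fun v => M * `|v a|)).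
  - by apply: measurable_funM => //; exact: measurable_coord.
  - by move=> v; rewrite normrM mulrC ler_wpM2r.
  - by apply: integrableZl_EFin; exact: integrable_norm_EFin.
have [_ ->] : mu.-integrable setT (EFin \o avg a (fun v => v a * F v)) /\
    \int[mu]_v (v a * F v) = \int[mu]_v avg a (fun v => v a * F v) v.
  apply: integral_resampling => // v.
  apply: (@le_integrable_EFin _ _ _ gam _ (fun x => M * (1 + x ^+ 2))).
  - rewrite /upd eqxx; apply: measurable_funM => //; exact: mFv.
  - move=> x; rewrite normrM mulrC /upd eqxx ler_pM //.
    by have := sqr_ge0 (`|x| - 1); have := real_normK (num_real x); nra.
  - apply: integrableZl_EFin; apply: integrableD_EFin.
      exact: integrable_cst_EFin.
    exact: integrable_sqr_normal_prob.
have [_ ->] : mu.-integrable setT (EFin \o avg a F') /\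
    \int[mu]_v F' v = \int[mu]_v avg a F' v.
  apply: integral_resampling; first exact: (@bounded_integrable_EFin _ _ _ mu M).
  move=> v; apply: (@bounded_integrable_EFin _ _ _ gam M) => //.
  exact: (measurableT_comp mF' (measurable_updl a v)).
apply: eq_Rintegral => v _; rewrite /avg.
under eq_Rintegral => x _ do rewrite {1}/upd eqxx.
exact: (gaussian_integration_by_parts (M := M)).
Qed.

End resampling.

(** * Replicas and Gibbs measures *)

Section replicas.
Context {R : realType} {S : finType}.
Implicit Types (G : S -> R) (n : nat).

(** The sum of [gibbs_mean] for an arbitrary weight on a finite set; for Gibbs weights the two are
    convertible. *)
Definition replica_mean G n (F : ('I_n -> S) -> R) : R :=
  \sum_(s : {ffun 'I_n -> S}) F s * \prod_(l < n) G (s l).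

(** Its body is that of the local [first_n] in [gg_delta], so that the two agree by unfolding. *)
Definition first_replicas n (s : 'I_n.+1 -> S) (k : 'I_n) : S :=
  s (widen_ord (leqnSn n) k).

Definition add_replica n (p : {ffun 'I_n -> S} * S) : {ffun 'I_n.+1 -> S} :=
  [ffun i => if unlift ord_max i is Some j then p.1 j else p.2].

Lemma widen_ord_lift n (k : 'I_n) : widen_ord (leqnSn n) k = lift ord_max k.
Proof. by apply: val_inj; rewrite /= /bump leqNgt ltn_ord. Qed.

Lemma add_replica_first n p (k : 'I_n) : add_replica p (widen_ord (leqnSn n) k) = p.1 k.
Proof. by rewrite ffunE widen_ord_lift liftK. Qed.

Lemma add_replica_last n p : add_replica p (@ord_max n) = p.2.
Proof. by rewrite ffunE unlift_none. Qed.

Lemma add_replica_bij n : bijective (@add_replica n).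
Proof.
exists (fun s : {ffun 'I_n.+1 -> S} => ([ffun k => first_replicas s k], s ord_max)).
  move=> [s t]; rewrite add_replica_last; congr pair; apply/ffunP => k.
  by rewrite ffunE /first_replicas add_replica_first.
move=> s; apply/ffunP => i; rewrite ffunE /=; case: unliftP => [j ->|-> //].
by rewrite ffunE /first_replicas widen_ord_lift.
Qed.

Lemma replica_mean_recr G n (F : ('I_n.+1 -> S) -> R) :
  replica_mean G F = \sum_(s : {ffun 'I_n -> S}) \sum_(t : S)
    F (add_replica (s, t)) * (\prod_(l < n) G (s l) * G t).
Proof.
rewrite /replica_mean (reindex _ (onW_bij _ (@add_replica_bij n))) /=.
rewrite pair_bigA /=; apply: eq_bigr => -[s t] _; rewrite big_ord_recr /=.
rewrite add_replica_last; congr (_ * (_ * _)).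
by apply: eq_bigr => k _; rewrite add_replica_first.
Qed.

Lemma first_replicas_ord0 n (s : 'I_n.+2 -> S) : first_replicas s ord0 = s ord0.
Proof. by congr (s _); exact: val_inj. Qed.

(** The last replica is independent of the others given the weight. Read from right to left, this
    turns a product of two means into one mean with an additional replica. *)
Lemma replica_mean_first_last G n (F : ('I_n -> S) -> R) (a : S -> R) :
  replica_mean G (fun s : 'I_n.+1 -> S => F (first_replicas s) * a (s ord_max)) =
  replica_mean G F * \sum_t a t * G t.
Proof.
rewrite replica_mean_recr mulr_suml; apply: eq_bigr => s _.
rewrite mulr_sumr; apply: eq_bigr => t _; rewrite add_replica_last /=.
have -> : first_replicas (add_replica (s, t)) = s.
  by apply/funext => k; rewrite /first_replicas add_replica_first.
by ring.
Qed.

Lemma replica_meanD G n (F F' : ('I_n -> S) -> R) :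
  replica_mean G (fun s => F s + F' s) = replica_mean G F + replica_mean G F'.
Proof. by rewrite /replica_mean -big_split; apply: eq_bigr => s _; rewrite mulrDl. Qed.

Lemma replica_meanZ G n (k : R) (F : ('I_n -> S) -> R) :
  replica_mean G (fun s => k * F s) = k * replica_mean G F.
Proof. by rewrite /replica_mean mulr_sumr; apply: eq_bigr => s _; rewrite mulrA. Qed.

Lemma replica_meanB G n (F F' : ('I_n -> S) -> R) :
  replica_mean G (fun s => F s - F' s) = replica_mean G F - replica_mean G F'.
Proof. by rewrite /replica_mean -sumrB; apply: eq_bigr => s _; rewrite mulrBl. Qed.

Lemma replica_mean_sum G n (J : finType) (P : pred J) (F : J -> ('I_n -> S) -> R) :
  replica_mean G (fun s => \sum_(j | P j) F j s) = \sum_(j | P j) replica_mean G (F j).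
Proof.
by rewrite /replica_mean exchange_big; apply: eq_bigr => s _; rewrite mulr_suml.
Qed.

Lemma eq_replica_mean G n (F F' : ('I_n -> S) -> R) :
  F =1 F' -> replica_mean G F = replica_mean G F'.
Proof. by move=> FF'; apply: eq_bigr => s _; rewrite FF'. Qed.

Lemma replica_mean_first_replicas G n (F : ('I_n -> S) -> R) : \sum_t G t = 1 ->
  replica_mean G (fun s : 'I_n.+1 -> S => F (first_replicas s)) = replica_mean G F.
Proof.
move=> G1; have := replica_mean_first_last G F (fun=> 1).
under eq_bigr do rewrite mul1r; rewrite G1 mulr1 => <-.
by apply: eq_replica_mean => s; rewrite mulr1.
Qed.

(** By Leibniz' rule every replica contributes its own [A] minus the mean of [A]; the [n] equal
    products with that mean are then expressed through one new replica. *)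
Lemma is_derive_replica_mean (G : R -> S -> R) (A : S -> R) (x : R) n
    (F : ('I_n -> S) -> R) :
  \sum_t G x t = 1 ->
  (forall s, is_derive x 1 (fun y => G y s) (G x s * (A s - \sum_t A t * G x t))) ->
  is_derive x 1 (fun y => replica_mean (G y) F)
    (replica_mean (G x) (fun s : 'I_n.+1 -> S => F (first_replicas s) *
      (\sum_(l < n) A (first_replicas s l) - n%:R * A (s ord_max)))).
Proof.
move=> G1 dG.
have dsum (J : Type) (r : seq J) (f : J -> R -> R) (df : J -> R) :
    (forall j, is_derive x 1 (f j) (df j)) ->
    is_derive x 1 (fun y => \sum_(j <- r) f j y) (\sum_(j <- r) df j).
  move=> dfj; elim: r => [|j r IH].
    under eq_fun do rewrite big_nil; rewrite big_nil; exact: is_derive_cst.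
  under eq_fun do rewrite big_cons; rewrite big_cons; exact: is_deriveD.
have dprod (r : seq 'I_n) (s : 'I_n -> S) :
    is_derive x 1 (fun y => \prod_(l <- r) G y (s l))
      (\prod_(l <- r) G x (s l) * \sum_(l <- r) (A (s l) - \sum_t A t * G x t)).
  elim: r => [|l r IH].
    under eq_fun do rewrite big_nil; rewrite !big_nil mulr0; exact: is_derive_cst.
  under eq_fun do rewrite big_cons; rewrite !big_cons.
  by apply: (is_derive_eq (is_derive1M (dG (s l)) IH)); ring.
have dterm (s : {ffun 'I_n -> S}) := is_derive1M (is_derive_cst (F s) x 1)
  (dprod (index_enum _) s).
apply: (is_derive_eq (dsum _ _ _ _ dterm)).
transitivity (replica_mean (G x)
    (fun s => F s * \sum_(l < n) (A (s l) - \sum_t A t * G x t))).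
  by apply: eq_bigr => s _; rewrite mulr0 addr0 -mulrA [X in _ * X]mulrC.
set c := \sum_t A t * G x t.
have E1 : replica_mean (G x) (fun s : 'I_n.+1 -> S => F (first_replicas s) *
    (\sum_(l < n) A (first_replicas s l) - n%:R * A (s ord_max))) =
    replica_mean (G x) (fun s => F s * \sum_(l < n) A (s l)) -
    n%:R * (replica_mean (G x) F * c).
  rewrite -(replica_mean_first_replicas (fun s => F s * \sum_(l < n) A (s l)) G1).
  rewrite -replica_mean_first_last -mulNr -replica_meanZ -replica_meanD.
  by apply: eq_replica_mean => s; ring.
rewrite E1 -mulNr mulrA mulrC mulrA -replica_meanZ -replica_meanD.
apply: eq_replica_mean => s.
by rewrite sumrB sumr_const card_ord -[c *+ n]mulr_natl; ring.
Qed.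


Lemma replica_mean_ord0 G n (phi : S -> R) : \sum_t G t = 1 ->
  replica_mean G (fun s : 'I_n.+1 -> S => phi (s ord0)) = \sum_t phi t * G t.
Proof.
move=> G1.
(* The observable is put into the factor of replica 0. Distributing the product of sums gives the
   multiple sum over replicas, and every other factor is 1. *)
transitivity (\prod_(l < n.+1) \sum_t (if l == ord0 then phi t else 1) * G t).
  rewrite bigA_distr_bigA /=; apply: eq_bigr => s _.
  by rewrite big_split /=; congr (_ * _); rewrite big_ord_recl big1 ?mulr1.
rewrite big_ord_recl /= [X in _ * X]big1 ?mulr1 // => l _.
by under eq_bigr do rewrite mul1r.
Qed.

Lemma replica_mean_cst G n (c : R) : \sum_t G t = 1 ->
  replica_mean G (fun _ : 'I_n -> S => c) = c.
Proof.
move=> G1; rewrite /replica_mean -mulr_sumr -(bigA_distr_bigA (fun _ => G)) big1 //.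
by rewrite mulr1.
Qed.

Lemma replica_mean_norm_le G n (M : R) (F : ('I_n -> S) -> R) :
  (forall t, 0 <= G t) -> \sum_t G t = 1 -> (forall s : {ffun 'I_n -> S}, `|F s| <= M) ->
  `|replica_mean G F| <= M.
Proof.
move=> G0 G1 FM; apply: (le_trans (ler_norm_sum _ _ _)).
have M1 : \sum_(s : {ffun 'I_n -> S}) \prod_(l < n) G (s l) = 1.
  by rewrite -(bigA_distr_bigA (fun _ => G)) big1.
rewrite -[leRHS]mulr1 -[X in _ <= _ * X]M1 mulr_sumr; apply: ler_sum => s _.
have p0 : 0 <= \prod_(l < n) G (s l) by apply: prodr_ge0.
by rewrite normrM (ger0_norm p0) ler_wpM2r.
Qed.

End replicas.

(** * Gibbs measures whose exponent is linear in the disorder *)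

Section linear_disorder.
Context {R : realType} {I S : finType} (A : I -> S -> R) (B : S -> R) (s0 : S).
Implicit Types (v : vec R I) (a : I) (s : S).

(** This is the exponent, that is, minus the Hamiltonian. One coefficient [A a s] per disorder
    variable treats couplings and fields alike. *)
Definition energy v s : R := \sum_a A a s * v a + B s.

Definition partition_sum v : R := \sum_s expR (energy v s).

Definition gibbs_weight v s : R := expR (energy v s) / partition_sum v.

Lemma partition_sum_gt0 v : 0 < partition_sum v.
Proof.
rewrite /partition_sum (bigD1 s0) //=; apply: ltr_pwDl; first exact: expR_gt0.
by apply: sumr_ge0 => s _; exact: expR_ge0.
Qed.

Lemma gibbs_weight_ge0 v s : 0 <= gibbs_weight v s.
Proof. by rewrite divr_ge0 ?expR_ge0 // ltW // partition_sum_gt0. Qed.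

Lemma gibbs_weight_sum1 v : \sum_s gibbs_weight v s = 1.
Proof. by rewrite -mulr_suml divff // gt_eqF // partition_sum_gt0. Qed.

Lemma energy_upd a x v s : energy (upd a x v) s = A a s * x + energy (upd a 0 v) s.
Proof.
rewrite /energy (bigD1 a) //= [in RHS](bigD1 a) //= /upd !eqxx mulr0 add0r addrA.
by congr (_ + _ + _); apply: eq_bigr => b /negbTE ->.
Qed.

(** The logarithm of the partition sum has the Gibbs mean of [A a] as its derivative, so the
    logarithm of the weight has derivative [A a s] minus that mean. *)
Lemma is_derive_gibbs_weight a v (x : R) s :
  is_derive x 1 (fun y => gibbs_weight (upd a y v) s)
    (gibbs_weight (upd a x v) s *
      (A a s - \sum_t A a t * gibbs_weight (upd a x v) t)).
Proof.
have dE t : is_derive x 1 (fun y => expR (energy (upd a y v) t))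
    (A a t * expR (energy (upd a x v) t)).
  under eq_fun => y do rewrite (energy_upd a y).
  rewrite (energy_upd a x).
  exact: (is_derive1_expR (is_derive1_affine _ _ x)).
have dZ : is_derive x 1 (fun y => partition_sum (upd a y v))
    (\sum_t A a t * expR (energy (upd a x v) t)).
  rewrite /partition_sum; elim: (index_enum S) => [|t r IH].
    under eq_fun do rewrite big_nil; rewrite big_nil; exact: is_derive_cst.
  by under eq_fun do rewrite big_cons; rewrite big_cons; exact: is_deriveD.
have Z0 : partition_sum (upd a x v) != 0 by rewrite gt_eqF // partition_sum_gt0.
apply: (is_derive_eq (is_derive1M (dE s) (is_deriveV Z0 dZ))).
under [X in _ = _ * (_ - X)]eq_bigr do rewrite mulrA.
rewrite -mulr_suml /gibbs_weight /GRing.scale /= ; field.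
exact: Z0.
Qed.

Lemma measurable_energy s : measurable_fun setT (fun v => energy v s).
Proof.
apply: measurable_funD => //; apply: measurable_sum => a.
by apply: measurable_funM => //; exact: measurable_coord.
Qed.

Lemma measurable_ln_partition_sum : measurable_fun setT (fun v => ln (partition_sum v)).
Proof.
apply: (measurableT_comp (@measurable_ln R)); apply: measurable_sum => s.
by apply: measurableT_comp => //; exact: measurable_energy.
Qed.

Lemma measurable_gibbs_weight s : measurable_fun setT (fun v => gibbs_weight v s).
Proof.
have -> : (fun v => gibbs_weight v s) = (fun v => expR (energy v s - ln (partition_sum v))).
  by apply/funext => v; rewrite expRD expRN lnK // posrE partition_sum_gt0.
apply: measurableT_comp => //; apply: measurable_funB.
  exact: measurable_energy.
exact: measurable_ln_partition_sum.
Qed.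

Lemma measurable_replica_mean n (F : ('I_n -> S) -> R) :
  measurable_fun setT (fun v => replica_mean (gibbs_weight v) F).
Proof.
apply: measurable_sum => s; apply: measurable_funM => //.
apply: measurable_prod => l _; exact: measurable_gibbs_weight.
Qed.

(** A crude bound, but uniform in the disorder, as integrability and integration by parts
    require. *)
Lemma replica_mean_bounded n (F : ('I_n -> S) -> R) v :
  `|replica_mean (gibbs_weight v) F| <= \sum_(s : {ffun 'I_n -> S}) `|F s|.
Proof.
apply: replica_mean_norm_le.
- exact: gibbs_weight_ge0.
- exact: gibbs_weight_sum1.
- by move=> s; rewrite (bigD1 s) //= lerDl sumr_ge0.
Qed.

(** Moving the coordinate [a] from [y] to [x] multiplies each exponential, hence their sum, by at
    most exp (c a |x - y|). *)
Lemma ln_partition_sum_coord_lip (c : I -> R) : (forall a s, `|A a s| <= c a) ->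
  coord_lip c (fun v => ln (partition_sum v)).
Proof.
move=> cA a.
have half x y v : ln (partition_sum (upd a x v)) - ln (partition_sum (upd a y v)) <= c a * `|x - y|.
  rewrite lerBlDr -ler_expR expRD !lnK ?posrE ?partition_sum_gt0 // mulr_sumr.
  apply: ler_sum => s _; rewrite -expRD ler_expR (energy_upd a x) (energy_upd a y).
  rewrite -lerBlDr opprD addrACA subrr addr0 -mulrBr (le_trans (ler_norm _)) // normrM.
  by rewrite ler_wpM2r.
move=> x y v; rewrite ler_norml half andbT -lerN2 opprB opprK distrC.
exact: half.
Qed.

Lemma gibbs_integration_by_parts (mu : probability (vec R I) R) :
  resampling_invariant mu -> forall a n (F : ('I_n -> S) -> R),
  \int[mu]_v (v a * replica_mean (gibbs_weight v) F) =
  \int[mu]_v replica_mean (gibbs_weight v) (fun s : 'I_n.+1 -> S =>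
    F (first_replicas s) *
      (\sum_(l < n) A a (first_replicas s l) - n%:R * A a (s ord_max))).
Proof.
move=> hmu a n F.
pose F' (s : 'I_n.+1 -> S) := F (first_replicas s) *
  (\sum_(l < n) A a (first_replicas s l) - n%:R * A a (s ord_max)).
rewrite -/F'.
have dF k (H : ('I_k -> S) -> R) v (x : R) := is_derive_replica_mean H
  (gibbs_weight_sum1 (upd a x v)) (is_derive_gibbs_weight a v x).
(* A single constant has to bound the mean of [F] and that of its derivative, hence the sum of the
   two bounds. *)
apply: (integral_coord_mul hmu (M := \sum_(s : {ffun 'I_n -> S}) `|F s| +
  \sum_(s : {ffun 'I_n.+1 -> S}) `|F' s|)).
- exact: measurable_replica_mean.
- exact: measurable_replica_mean.
- by move=> v; rewrite (le_trans (replica_mean_bounded _ _)) // lerDl sumr_ge0.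
- by move=> v; rewrite (le_trans (replica_mean_bounded _ _)) // lerDr sumr_ge0.
(* The derivative is again a replica mean, with one more replica, so it is differentiable in its
   turn and in particular continuous. *)
- move=> v x; apply: differentiable_continuous; apply/derivable1_diffP.
  by have := dF _ F' v x; case.
Qed.

End linear_disorder.

(** * Mean absolute deviation from exponential moments *)

Section exponential_bound.
Context {R : realType} {S : finType} (G : S -> R).
Hypotheses (G0 : forall s, 0 <= G s) (G1 : \sum_s G s = 1).

(* Jensen's inequality for the exponential, with [exp |y| <= exp y + exp (- y)]. *)
Lemma mean_norm_le_ln (Y : S -> R) (t : R) : 0 <= t ->
  t * (\sum_s `|Y s| * G s) <= ln 2 + `|ln (\sum_s expR (t * Y s) * G s)| +
    `|ln (\sum_s expR (- (t * Y s)) * G s)|.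
Proof.
move=> t0; set a := \sum_s expR (t * Y s) * G s.
set b := \sum_s expR (- (t * Y s)) * G s; set c := (X in _ <= X).
have a0 : 0 <= a by apply: sumr_ge0 => s _; rewrite mulr_ge0 ?expR_ge0.
have b0 : 0 <= b by apply: sumr_ge0 => s _; rewrite mulr_ge0 ?expR_ge0.
have expc : expR c = 2 * (expR `|ln a| * expR `|ln b|).
  by rewrite /c -addrA !expRD lnK // posrE.
(* Only [0 <= a] and [0 <= b] have been established, so x = 0, where [ln] takes a default value, is
   treated apart. *)
have le_expln (x y : R) : 0 <= x -> 1 <= y -> x <= expR `|ln x| * y.
  move=> x0 y1; rewrite -[leLHS]mulr1 ler_pM //.
  have [->|x1] := eqVneq x 0; first exact: expR_ge0.
  by rewrite -[leLHS](lnK (x := x)) ?posrE ?lt_neqAle 1?eq_sym ?x1 // ler_expR ler_norm.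
have e1 (x : R) : 1 <= expR `|x| by rewrite -expR0 ler_expR.
have abc : a + b <= expR c.
  rewrite expc mulr_natl mulr2n lerD //; first exact: le_expln.
  by rewrite mulrC le_expln.
(* This is 1 + z <= exp z at z = t |Y s| - c. The point [c] is chosen so that [a + b <= expR c],
   which makes the last term at most 1 on average and cancels the - 1. *)
have pw s : t * `|Y s| <= c - 1 + (expR (t * Y s) + expR (- (t * Y s))) * expR (- c).
  have h : expR (t * `|Y s|) <= expR (t * Y s) + expR (- (t * Y s)).
    by case: ger0P => _; rewrite ?mulrN ?lerDl ?lerDr ?expR_ge0.
  have := expR_ge1Dx (t * `|Y s| - c); rewrite expRD => h1.
  rewrite -lerBlDl; apply: (le_trans _ (ler_wpM2r (expR_ge0 (- c)) h)).
  by rewrite opprB addrCA; exact: h1.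
have sE : \sum_s (c - 1 + (expR (t * Y s) + expR (- (t * Y s))) * expR (- c)) * G s =
    c - 1 + (a + b) * expR (- c).
  under eq_bigr do rewrite mulrDl mulrAC.
  rewrite big_split /= -mulr_sumr G1 mulr1 -mulr_suml.
  by under eq_bigr do rewrite mulrDl; rewrite big_split.
rewrite mulr_sumr; apply: (@le_trans _ _ (c - 1 + (a + b) * expR (- c))).
  rewrite -sE; apply: ler_sum => s _; rewrite mulrA; exact: ler_wpM2r.
rewrite -lerBrDl opprB addrCA subrr addr0.
by rewrite expRN ler_pdivrMr ?expR_gt0 // mul1r.
Qed.

End exponential_bound.

(** * The Sherrington-Kirkpatrick model *)

Section sk_model.
Context {R : realType} {N : nat}.
Implicit Types (v : vec R (disorder N)) (s t : config N) (beta gamma h : R).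

Definition sk_coef beta gamma (a : disorder N) s : R :=
  match a with
  | inl e => beta / Num.sqrt N%:R * (spin s (val e).1 * spin s (val e).2)
  | inr i => gamma * spin s i
  end.

Definition sk_field h s : R := h * \sum_i spin s i.

(** Any configuration would do: it witnesses that the partition function is a nonempty sum. *)
Definition sk_some : config N := [ffun=> true].

Lemma sk_energyE beta gamma h v s :
  energy (sk_coef beta gamma) (sk_field h) v s = - hamiltonian beta gamma h v s.
Proof.
rewrite /energy /hamiltonian opprK big_sumType /= /sk_field.
rewrite -addrA [X in _ + X]addrC addrA; congr (_ + _ + _); rewrite mulr_sumr.
  by apply: eq_bigr => e _; ring.
by apply: eq_bigr => i _; ring.
Qed.

Lemma sk_partitionE beta gamma h v :
  partition_sum (sk_coef beta gamma) (sk_field h) v = partition_function beta gamma h v.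
Proof. by apply: eq_bigr => s _; rewrite sk_energyE. Qed.

Lemma sk_gibbsE beta gamma h v :
  gibbs_weight (sk_coef beta gamma) (sk_field h) v = gibbs beta gamma h v.
Proof. by apply/funext => s; rewrite /gibbs_weight sk_energyE sk_partitionE. Qed.

Lemma normr_spin s (i : 'I_N) : `|spin s i : R| = 1.
Proof. by rewrite /spin; case: (s i); rewrite ?normrN normr1. Qed.

Lemma spin_sqr s (i : 'I_N) : spin s i * spin s i = 1 :> R.
Proof. by rewrite /spin; case: (s i); rewrite ?mulrNN mulr1. Qed.

Lemma overlap_self s : (0 < N)%N -> overlap s s = 1 :> R.
Proof.
move=> N0; rewrite /overlap; under eq_bigr do rewrite spin_sqr.
by rewrite sumr_const card_ord mulVf // pnatr_eq0 -lt0n.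
Qed.

Definition sk_lip beta gamma (a : disorder N) : R :=
  match a with inl _ => `|beta / Num.sqrt N%:R| | inr _ => `|gamma| end.

Lemma sk_coef_le beta gamma a s : `|sk_coef beta gamma a s| <= sk_lip beta gamma a.
Proof. by case: a => [e|i] /=; rewrite !normrM !normr_spin !mulr1. Qed.

Lemma measurable_free_energy beta gamma h :
  measurable_fun setT (fun v => free_energy beta gamma h v).
Proof.
apply: measurable_funM => //.
have -> : (fun v => ln (partition_function beta gamma h v)) =
    (fun v => ln (partition_sum (sk_coef beta gamma) (sk_field h) v)).
  by apply/funext => v; rewrite sk_partitionE.
exact: measurable_ln_partition_sum.
Qed.

Lemma free_energy_coord_lip beta gamma h :
  coord_lip (fun a => N%:R^-1 * sk_lip beta gamma a) (fun v => free_energy beta gamma h v).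
Proof.
move=> a x y v; rewrite /free_energy -mulrBr normrM ger0_norm ?invr_ge0 //.
rewrite -mulrA ler_wpM2l ?invr_ge0 // -!sk_partitionE.
by apply: ln_partition_sum_coord_lip; [exact: sk_some|exact: sk_coef_le].
Qed.

(** There are N (N - 1) / 2 couplings with squared constant beta^2 / N^3 and N fields with gamma^2 /
    N^2; the number of couplings is bounded crudely by N^2. *)
Lemma sum_sqr_sk_lip beta gamma : (0 < N)%N ->
  \sum_a (N%:R^-1 * sk_lip beta gamma a) ^+ 2 <= (beta ^+ 2 + gamma ^+ 2) / N%:R.
Proof.
move=> N0; have Nr : 0 < N%:R :> R by rewrite ltr0n.
rewrite big_sumType /= !sumr_const card_pairs card_ord.
rewrite !exprMn !real_normK ?num_real // exprMn !exprVn sqr_sqrtr ?ler0n //.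
rewrite mulrDl lerD //; last first.
  rewrite -[leLHS]mulr_natl le_eqVlt; apply/orP; left; apply/eqP; field.
  by rewrite gt_eqF.
rewrite -[leLHS]mulr_natl.
have le2 : ((N * N.-1)./2)%:R <= N%:R ^+ 2 :> R.
  rewrite -natrX ler_nat -mulnn (leq_trans _ (leq_mul (leqnn N) (leq_pred N))) //.
  by rewrite -[X in (_ <= X)%N](odd_double_half) -addnn addnA leq_addl.
rewrite [leRHS](_ : _ = N%:R ^+ 2 * ((N%:R ^+ 2)^-1 * (beta ^+ 2 / N%:R))); last first.
  by field; rewrite gt_eqF.
apply: ler_wpM2r => //; rewrite mulr_ge0 ?invr_ge0 ?exprn_ge0 ?(ltW Nr) //.
by rewrite mulr_ge0 ?sqr_ge0 ?invr_ge0 ?(ltW Nr).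
Qed.

(** The quantity L of the overview: [N] times it is the derivative of minus the Hamiltonian with
    respect to [gamma]. *)
Definition field_energy v s : R := N%:R^-1 * \sum_i v (inr i) * spin s i.

Lemma hamiltonianD beta gamma h (dl : R) v s : (0 < N)%N ->
  - hamiltonian beta (gamma + dl) h v s =
  - hamiltonian beta gamma h v s + N%:R * dl * field_energy v s.
Proof.
move=> N0; rewrite /hamiltonian /field_energy !opprK mulrDl.
by rewrite addrA; congr (_ + _); field; rewrite pnatr_eq0 -lt0n.
Qed.

Lemma sk_partition_function_gt0 beta gamma h v : 0 < partition_function beta gamma h v.
Proof. by rewrite -sk_partitionE; exact: (partition_sum_gt0 _ _ sk_some). Qed.

Lemma mean_exp_field_energy beta gamma h (dl m : R) v : (0 < N)%N ->
  ln (\sum_s expR (N%:R * dl * (field_energy v s - m)) * gibbs beta gamma h v s) =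
  N%:R * (free_energy beta (gamma + dl) h v - free_energy beta gamma h v - dl * m).
Proof.
move=> N0; have N1 : N%:R != 0 :> R by rewrite pnatr_eq0 -lt0n.
have -> : \sum_s expR (N%:R * dl * (field_energy v s - m)) * gibbs beta gamma h v s =
    expR (- (N%:R * dl * m)) *
    (partition_function beta (gamma + dl) h v / partition_function beta gamma h v).
  rewrite /partition_function mulrA mulr_sumr mulr_suml; apply: eq_bigr => s _.
  rewrite /gibbs mulrA -!expRD; congr (expR _ / _).
  by rewrite hamiltonianD //; ring.
have Z1 := sk_partition_function_gt0 beta gamma h v.
have Z2 := sk_partition_function_gt0 beta (gamma + dl) h v.
rewrite lnM ?posrE ?expR_gt0 ?divr_gt0 // ln_div ?posrE // expRK /free_energy.
by field.
Qed.

(** The exponential bound with t = N dl, at fixed disorder. The increment towards [gamma - dl] is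
    divided by [dl] and not by [- dl], so it is compared with [- m], whence the sign in the last
    term. *)
Lemma field_energy_deviation beta gamma h (dl m : R) v : (0 < N)%N -> 0 < dl ->
  \sum_s `|field_energy v s - m| * gibbs beta gamma h v s <=
  ln 2 / (N%:R * dl) +
  `|(free_energy beta (gamma + dl) h v - free_energy beta gamma h v) / dl - m| +
  `|(free_energy beta (gamma - dl) h v - free_energy beta gamma h v) / dl + m|.
Proof.
move=> N0 dl0; have Nr : 0 < N%:R :> R by rewrite ltr0n.
have G1 : \sum_s gibbs beta gamma h v s = 1.
  by rewrite -sk_gibbsE; exact: (gibbs_weight_sum1 _ _ sk_some).
have G0 s : 0 <= gibbs beta gamma h v s.
  by rewrite -sk_gibbsE; exact: (gibbs_weight_ge0 _ _ sk_some).
have t0 : 0 < N%:R * dl by rewrite mulr_gt0.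
have := mean_norm_le_ln G0 G1 (fun s => field_energy v s - m) (ltW t0).
have E2 s : - (N%:R * dl * (field_energy v s - m)) =
    N%:R * - dl * (field_energy v s - m) by ring.
under [X in _ + `|ln X|]eq_bigr do rewrite E2.
rewrite !mean_exp_field_energy // mulrC -ler_pdivlMr // => /le_trans; apply.
have E x : `|N%:R * x| / (N%:R * dl) = `|x / dl|.
  by rewrite !normrM normfV (gtr0_norm Nr) (gtr0_norm dl0); field; rewrite !gt_eqF.
rewrite 2!mulrDl !E le_eqVlt; apply/orP; left; apply/eqP.
by congr (_ + _ + _); congr (`|_|); field; rewrite gt_eqF.
Qed.

End sk_model.

(** * Expectations over the Gaussian disorder *)

Section sk_expectation.
Context {R : realType} {N : nat} {d} {T : measurableType d} {P : probability T R}.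
Variable g : disorder N -> {RV P >-> R}.
Hypotheses (g_iid : iid_standard_gaussian g) (N_gt0 : (0 < N)%N).
Local Notation mu := (joint_law g).
Implicit Types (v : vec R (disorder N)) (beta gamma h : R) (F : vec R (disorder N) -> R).

Lemma expectation_joint_law F : mu.-integrable setT (EFin \o F) ->
  fine 'E_P[fun w => F (fun a => g a w)] = \int[mu]_v F v.
Proof.
move=> iF; have mF : measurable_fun setT (EFin \o F) by exact: measurable_int iF.
have mj := measurable_joint g.
rewrite unlock /Rintegral; congr fine.
rewrite (integral_pushforward mj mF) ?preimage_setT //.
apply/integrableP; split; first exact: (measurableT_comp mF mj).
have /integrableP[_] := iF.
rewrite (ge0_integral_pushforward mj) ?preimage_setT //.
by apply: measurableT_comp.
Qed.

Lemma sk_mu_resampling : resampling_invariant mu.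
Proof. exact: joint_law_resampling. Qed.

Lemma free_energy_sqr_integrable beta gamma h :
  sqr_integrable mu (fun v => free_energy beta gamma h v).
Proof.
apply: coord_lip_sqr_integrable.
- exact: sk_mu_resampling.
- exact: measurable_free_energy.
- exact: free_energy_coord_lip.
Qed.

Lemma mean_free_energyE beta gamma h :
  mean_free_energy g beta gamma h = \int[mu]_v free_energy beta gamma h v.
Proof.
apply: (@expectation_joint_law (fun v => free_energy beta gamma h v)).
exact: sqr_integrable_integrable (free_energy_sqr_integrable _ _ _).
Qed.

Lemma free_energy_variance beta gamma h :
  \int[mu]_v ((free_energy beta gamma h v - mean_free_energy g beta gamma h) ^+ 2) <=
  gaussian_sqr_moment * ((beta ^+ 2 + gamma ^+ 2) / N%:R).
Proof.
rewrite mean_free_energyE.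
apply: (le_trans (coord_lip_variance sk_mu_resampling
  (measurable_free_energy _ _ _) (@free_energy_coord_lip _ _ _ _ _))).
by rewrite ler_wpM2l ?gaussian_sqr_moment_ge0 // sum_sqr_sk_lip.
Qed.

(** Averaging |X| <= e + X^2 / e turns the variance bound into a bound on the mean absolute
    deviation; the free parameter [e] stands in for a square root. *)
Lemma free_energy_abs_deviation beta gamma h (e : R) : 0 < e ->
  \int[mu]_v `|free_energy beta gamma h v - mean_free_energy g beta gamma h| <=
  e + gaussian_sqr_moment * ((beta ^+ 2 + gamma ^+ 2) / N%:R) / e.
Proof.
move=> e0; set m := mean_free_energy g beta gamma h.
have [mX iX2] : sqr_integrable mu (fun v => free_energy beta gamma h v + - m).
  apply: (@sqr_integrableD _ _ _ mu) => //.
    exact: free_energy_sqr_integrable.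
  exact: sqr_integrable_cst.
have iX := sqr_integrable_integrable (conj mX iX2).
apply: (@le_trans _ _ (\int[mu]_v (e + e^-1 * (free_energy beta gamma h v - m) ^+ 2))).
  apply: le_Rintegral => //.
  - exact: integrable_norm_EFin.
  - apply: integrableD_EFin; first exact: integrable_cst_EFin.
    exact: integrableZl_EFin.
  - move=> v _; rewrite -(real_normK (num_real _)); set x := `|_|.
    rewrite -(ler_pM2l e0) mulrDr mulrA divff ?gt_eqF // mul1r.
    by have := sqr_ge0 (e - x); have := normr_ge0 (free_energy beta gamma h v - m); nra.
rewrite RintegralD //; last 2 first.
- exact: integrable_cst_EFin.
- exact: integrableZl_EFin.
rewrite Rintegral_probability_cst RintegralZl // lerD2l mulrC.
by rewrite ler_wpM2r ?invr_ge0 ?(ltW e0) // free_energy_variance.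
Qed.

Variables (beta gamma h : R).
Local Notation G v := (gibbs beta gamma h v).

Lemma sk_gibbs_ge0 v s : 0 <= G v s.
Proof. by rewrite -sk_gibbsE; exact: (gibbs_weight_ge0 _ _ (sk_some)). Qed.

Lemma sk_gibbs_sum1 v : \sum_s G v s = 1.
Proof. by rewrite -sk_gibbsE; exact: (gibbs_weight_sum1 _ _ (sk_some)). Qed.

Lemma sk_gibbs_le1 v s : G v s <= 1.
Proof.
rewrite -(sk_gibbs_sum1 v) (bigD1 s) //= lerDl; apply: sumr_ge0 => t _.
exact: sk_gibbs_ge0.
Qed.

Lemma measurable_sk_gibbs s : measurable_fun setT (fun v => G v s).
Proof.
have -> : (fun v => G v s) =
    (fun v => gibbs_weight (sk_coef beta gamma) (sk_field h) v s).
  by apply/funext => v; rewrite sk_gibbsE.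
exact: measurable_gibbs_weight sk_some _.
Qed.

Lemma integrable_mul_bounded (M : R) F (b : vec R (disorder N) -> R) :
  mu.-integrable setT (EFin \o F) -> measurable_fun setT b -> (forall v, `|b v| <= M) ->
  mu.-integrable setT (EFin \o (fun v => F v * b v)).
Proof.
move=> iF mb bM; apply: (@le_integrable_EFin _ _ _ mu _ (fun v => M * `|F v|)).
- apply: measurable_funM => //; apply/measurable_EFinP; exact: measurable_int iF.
- by move=> v; rewrite normrM mulrC ler_wpM2r.
- by apply: integrableZl_EFin; exact: integrable_norm_EFin.
Qed.

Lemma integrable_replica_mean n (F : vec R (disorder N) -> ('I_n -> config N) -> R) :
  (forall s : {ffun 'I_n -> config N}, mu.-integrable setT (EFin \o (F ^~ s))) ->
  mu.-integrable setT (EFin \o (fun v => replica_mean (G v) (F v))).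
Proof.
move=> iF; apply: integrable_sum_EFin => s _.
apply: (@integrable_mul_bounded 1 (F ^~ s)) => //.
  by apply: measurable_prod => l _; exact: measurable_sk_gibbs.
move=> v; rewrite ger0_norm; last by apply: prodr_ge0 => l _; exact: sk_gibbs_ge0.
by apply: prodr_ile1 => l; rewrite sk_gibbs_ge0 sk_gibbs_le1.
Qed.

Lemma integrable_replica_mean_cst n (F : ('I_n -> config N) -> R) :
  mu.-integrable setT (EFin \o (fun v => replica_mean (G v) F)).
Proof. by apply: integrable_replica_mean => s; exact: integrable_cst_EFin. Qed.

Lemma nuE n (F : ('I_n -> config N) -> R) :
  nu g beta gamma h F = \int[mu]_v replica_mean (G v) F.
Proof.
apply: (@expectation_joint_law (fun v => gibbs_mean beta gamma h v F)).
exact: integrable_replica_mean_cst.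
Qed.

Lemma integrable_disorder (a : disorder N) : mu.-integrable setT (EFin \o (fun v => v a)).
Proof. exact: sqr_integrable_integrable (coord_sqr_integrable sk_mu_resampling a). Qed.

Lemma integrable_field_energy s : mu.-integrable setT (EFin \o (fun v => field_energy v s)).
Proof.
apply: integrableZl_EFin; apply: integrable_sum_EFin => i _.
have -> : (fun v => v (inr i) * spin s i) = (fun v => spin s i * v (inr i)).
  by apply/funext => v; rewrite mulrC.
by apply: integrableZl_EFin; exact: integrable_disorder.
Qed.

(** Integration by parts in [g_i] brings down [gamma] times the spin at site [i] of some replica;
    multiplied by the same spin of replica 0 and averaged over the sites, these spins become
    overlaps. The sum includes the overlap of replica 0 with itself. *)
Lemma sk_integration_by_parts n (F : ('I_n.+1 -> config N) -> R) :
  \int[mu]_v replica_mean (G v) (fun s => field_energy v (s ord0) * F s) =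
  gamma * (\sum_(l < n.+1) nu g beta gamma h (fun s => overlap (s ord0) (s l) * F s) -
    n.+1%:R * nu g beta gamma h (fun s : 'I_n.+2 -> config N =>
      overlap (s ord0) (s ord_max) * F (first_replicas s))).
Proof.
have E1 v : replica_mean (G v) (fun s => field_energy v (s ord0) * F s) =
    \sum_i N%:R^-1 * (v (inr i) * replica_mean (G v) (fun s => spin (s ord0) i * F s)).
  rewrite -mulr_sumr.
  under [in RHS]eq_bigr do rewrite -replica_meanZ.
  rewrite -replica_mean_sum -replica_meanZ; apply: eq_replica_mean => s.
  by rewrite /field_energy -mulrA mulr_suml; congr (_ * _); apply: eq_bigr => i _; rewrite mulrA.
under eq_Rintegral => v _ do rewrite E1.
have iterm i : mu.-integrable setT (EFin \o (fun v =>
    v (inr i) * replica_mean (G v) (fun s : 'I_n.+1 -> _ => spin (s ord0) i * F s))).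
  apply: (@integrable_mul_bounded (\sum_(s : {ffun 'I_n.+1 -> config N})
    `|spin (s ord0) i * F s|) (fun v => v (inr i))).
  - exact: integrable_disorder.
  - apply/measurable_EFinP; exact: measurable_int (integrable_replica_mean_cst _).
  - move=> v; rewrite -sk_gibbsE; apply: replica_mean_bounded; exact: sk_some.
rewrite Rintegral_sum; last by move=> i; exact: integrableZl_EFin.
(* The integrand given by [gibbs_integration_by_parts], with [sk_coef] at the field variable [inr i]
   as coefficient. *)
pose K (i : 'I_N) (s : 'I_n.+2 -> config N) := spin (first_replicas s ord0) i *
  F (first_replicas s) * (\sum_(l < n.+1) gamma * spin (first_replicas s l) i -
    n.+1%:R * (gamma * spin (s ord_max) i)).
have ibp i : \int[mu]_v (v (inr i) * replica_mean (G v)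
    (fun s : 'I_n.+1 -> _ => spin (s ord0) i * F s)) = \int[mu]_v replica_mean (G v) (K i).
  have GE v : G v = gibbs_weight (sk_coef beta gamma) (sk_field h) v.
    by rewrite sk_gibbsE.
  under eq_Rintegral => v _ do rewrite GE.
  under [RHS]eq_Rintegral => v _ do rewrite GE.
  exact: (gibbs_integration_by_parts _ _ sk_some sk_mu_resampling).
under eq_bigr => i _ do rewrite RintegralZl // ibp.
under eq_bigr => i _ do rewrite -(RintegralZl _ _ (integrable_replica_mean_cst (K i))) //.
rewrite -Rintegral_sum; last first.
  by move=> i; apply: integrableZl_EFin; exact: integrable_replica_mean_cst.
rewrite nuE; under [X in _ * (X - _)]eq_bigr do rewrite nuE.
rewrite -Rintegral_sum; last by move=> l; exact: integrable_replica_mean_cst.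
have isum : mu.-integrable setT (EFin \o (fun v => \sum_(l < n.+1) replica_mean (G v)
    (fun s : 'I_n.+1 -> _ => overlap (s ord0) (s l) * F s))).
  by apply: integrable_sum_EFin => l _; exact: integrable_replica_mean_cst.
rewrite -RintegralZl //; last exact: integrable_replica_mean_cst.
rewrite -RintegralB //; last first.
  by apply: integrableZl_EFin; exact: integrable_replica_mean_cst.
rewrite -RintegralZl //; last first.
  apply: integrableB_EFin => //.
  by apply: integrableZl_EFin; exact: integrable_replica_mean_cst.
apply: eq_Rintegral => v _.
(* From here the disorder is fixed: every term is lifted to a mean over [n.+2] replicas, and the
   integrands are compared. *)
under eq_bigr => i _ do rewrite -replica_meanZ.
under [X in _ = _ * (X - _)]eq_bigr => l _ do
  rewrite -(replica_mean_first_replicas _ (sk_gibbs_sum1 v)).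
rewrite -!replica_mean_sum -[n.+1%:R * _]replica_meanZ -replica_meanB -replica_meanZ.
apply: eq_replica_mean => s; rewrite /K /overlap first_replicas_ord0.
set F0 := F _; set a := spin (s ord0).
have -> : \sum_(l < n.+1) N%:R^-1 * (\sum_i a i * spin (first_replicas s l) i) * F0 =
    N%:R^-1 * (\sum_i a i * \sum_(l < n.+1) spin (first_replicas s l) i) * F0.
  rewrite -mulr_suml -mulr_sumr exchange_big; congr (_ * _ * _).
  by apply: eq_bigr => i _; rewrite mulr_sumr.
transitivity (\sum_i (gamma * F0 * N%:R^-1 *
    (a i * \sum_(l < n.+1) spin (first_replicas s l) i) -
    gamma * F0 * N%:R^-1 * n.+1%:R * (a i * spin (s ord_max) i))).
  by apply: eq_bigr => i _; rewrite -mulr_sumr; ring.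
by rewrite sumrB -!mulr_sumr; ring.
Qed.

(** Both means of L f and of L are integrated by parts. The self-overlap is 1 in each, so it
    contributes [nu(f)] twice with opposite signs, and the remaining terms make up the defect. *)
Lemma gg_delta_covariance k (f : ((k.+1 * k.+1.-1)./2).-tuple R -> R) :
  - (gamma * k.+1%:R * gg_delta g beta gamma h f) =
  \int[mu]_v replica_mean (G v)
      (fun s : 'I_k.+1 -> _ => field_energy v (s ord0) * f (overlaps s)) -
  \int[mu]_v replica_mean (G v) (fun s : 'I_1 -> _ => field_energy v (s ord0) * 1) *
    nu g beta gamma h (fun s : 'I_k.+1 -> _ => f (overlaps s)).
Proof.
have k0 : k.+1%:R != 0 :> R by rewrite pnatr_eq0.
rewrite !sk_integration_by_parts big_ord1 [X in _ - X * _]mulrBr.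
have -> : nu g beta gamma h (fun s : 'I_1 -> _ => overlap (s ord0) (s ord0) * 1) = 1.
  rewrite nuE -[RHS](Rintegral_probability_cst mu); apply: eq_Rintegral => v _.
  rewrite -[RHS](replica_mean_cst 1 1 (sk_gibbs_sum1 v)); apply: eq_replica_mean => s.
  by rewrite overlap_self // mulr1.
(* The condition [0 < l < n] discards the last index, then the first; the sum left over runs over
   the indices [lift ord0 i]. *)
rewrite /gg_delta big_mkcond big_ord_recr /= ltnn /= addr0.
rewrite big_ord_recl /= add0r [in RHS]big_ord_recl.
have -> : nu g beta gamma h (fun s : 'I_k.+1 -> _ =>
    overlap (s ord0) (s ord0) * f (overlaps s)) =
    nu g beta gamma h (fun s : 'I_k.+1 -> _ => f (overlaps s)).
  by rewrite !nuE; apply: eq_Rintegral => v _; apply: eq_replica_mean => s;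
    rewrite overlap_self // mul1r.
have -> : nu g beta gamma h (fun s : 'I_2 -> config N =>
    overlap (s ord0) (s ord_max) * 1) =
    nu g beta gamma h (fun s : 'I_2 -> config N => overlap (s ord0) (s ord_max)).
  by rewrite !nuE; apply: eq_Rintegral => v _; apply: eq_replica_mean => s;
    rewrite mulr1.
rewrite [\sum_(i < k) (if _ then _ else _)](_ : _ = \sum_(i < k) nu g beta gamma h
    (fun s : 'I_k.+1 -> _ => overlap (s ord0) (s (lift ord0 i)) * f (overlaps s))); last first.
  apply: eq_bigr => i _; have -> : (bump 0 i < k.+1)%N by rewrite ltnS ltn_ord.
  rewrite !nuE.
  (* In [gg_delta] these terms are taken over one replica more than they involve; the other side is
     lifted to match. *)
  apply: eq_Rintegral => v _; rewrite -[RHS](replica_mean_first_replicas _ (sk_gibbs_sum1 v)).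
  apply: eq_replica_mean => s; rewrite first_replicas_ord0.
  by congr (overlap _ (s _) * _).
rewrite /first_replicas; field.
by rewrite addrC natr1.
Qed.

Definition field_deviation (m : R) v : R := \sum_s `|field_energy v s - m| * G v s.

Lemma integrable_field_deviation m : mu.-integrable setT (EFin \o field_deviation m).
Proof.
apply: integrable_sum_EFin => s _; apply: (@integrable_mul_bounded 1).
- apply: integrable_norm_EFin; apply: integrableB_EFin; first exact: integrable_field_energy.
  exact: integrable_cst_EFin.
- exact: measurable_sk_gibbs.
- by move=> v; rewrite ger0_norm ?sk_gibbs_ge0 ?sk_gibbs_le1.
Qed.

(** The error of replacing L by the constant [m] involves |L - m| at replica 0 only; the remaining
    replicas integrate out to 1. *)
Lemma field_energy_mean_sub_le k (M m : R) (F : ('I_k.+1 -> config N) -> R) :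
  (forall s, `|F s| <= M) ->
  `|\int[mu]_v replica_mean (G v) (fun s => field_energy v (s ord0) * F s) -
    m * \int[mu]_v replica_mean (G v) F| <= M * \int[mu]_v field_deviation m v.
Proof.
move=> FM.
have iL : mu.-integrable setT (EFin \o (fun v => replica_mean (G v)
    (fun s => (field_energy v (s ord0) - m) * F s))).
  apply: (integrable_replica_mean (F := fun v s => (field_energy v (s ord0) - m) * F s)) => s.
  apply: (@integrable_mul_bounded `|F s|) => //.
  apply: integrableB_EFin; first exact: integrable_field_energy.
  exact: integrable_cst_EFin.
have iF := integrable_replica_mean_cst F.
have E v : replica_mean (G v) (fun s => field_energy v (s ord0) * F s) =
    replica_mean (G v) (fun s => (field_energy v (s ord0) - m) * F s) +
    m * replica_mean (G v) F.
  by rewrite -replica_meanZ -replica_meanD; apply: eq_replica_mean => s; ring.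
under eq_Rintegral => v _ do rewrite E.
rewrite RintegralD // ?RintegralZl ?addrK //; last exact: integrableZl_EFin.
have idev := integrable_field_deviation m.
apply: (le_trans (le_normr_Rintegral _ _)) => //; rewrite -RintegralZl //.
apply: le_Rintegral => //.
- exact: integrable_norm_EFin.
- exact: integrableZl_EFin.
move=> v _; apply: (le_trans (ler_norm_sum _ _ _)).
rewrite /field_deviation -(replica_mean_ord0 k (fun t => `|field_energy v t - m|)
  (sk_gibbs_sum1 v)) mulr_sumr.
apply: ler_sum => s _; rewrite 2!normrM mulrA [`|\prod_(l < _) _|]ger0_norm; last first.
  by apply: prodr_ge0 => l _; exact: sk_gibbs_ge0.
apply: ler_wpM2r; first by apply: prodr_ge0 => l _; exact: sk_gibbs_ge0.
by rewrite mulrC ler_wpM2r.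
Qed.

(** The covariance is (nu(L f) - m nu(f)) - (nu(L) - m) nu(f), and each part is at most [M] times
    the mean deviation, whence the factor 2. The factor [k.+1], being at least 1, is dropped. *)
Lemma gg_delta_le k (M m : R) (f : ((k.+1 * k.+1.-1)./2).-tuple R -> R) :
  (forall x, `|f x| <= M) ->
  `|gamma| * `|gg_delta g beta gamma h f| <= 2 * M * \int[mu]_v field_deviation m v.
Proof.
move=> fM; set D := \int[mu]_v _.
have D0 : 0 <= D.
  apply: Rintegral_ge0 => v _; apply: sumr_ge0 => s _.
  by rewrite mulr_ge0 ?sk_gibbs_ge0.
have M0 : 0 <= M by exact: le_trans (fM (overlaps (fun _ : 'I_k.+1 => @sk_some N))).
have nu_le : `|nu g beta gamma h (fun s : 'I_k.+1 -> _ => f (overlaps s))| <= M.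
  rewrite nuE; apply: (le_trans (le_normr_Rintegral _ _)) => //.
    exact: integrable_replica_mean_cst.
  rewrite -[leRHS](Rintegral_probability_cst mu); apply: le_Rintegral => //.
  - by apply: integrable_norm_EFin; exact: integrable_replica_mean_cst.
  - exact: integrable_cst_EFin.
  - move=> v _; apply: replica_mean_norm_le => //; last exact: sk_gibbs_sum1.
    by move=> s; exact: sk_gibbs_ge0.
have one_mean : \int[mu]_v replica_mean (G v) (fun s : 'I_1 -> _ => 1) = 1.
  rewrite -[RHS](Rintegral_probability_cst mu); apply: eq_Rintegral => v _.
  exact: replica_mean_cst (sk_gibbs_sum1 v).
have h1 : forall s : 'I_1 -> config N, `|1 : R| <= 1 by move=> s; rewrite normr1.
have hb := field_energy_mean_sub_le m h1.
have hf (s : 'I_k.+1 -> config N) : `|f (overlaps s)| <= M by exact: fM.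
have ha := field_energy_mean_sub_le m hf.
have := gg_delta_covariance f.
move: ha hb nu_le; rewrite -nuE one_mean mulr1 mul1r -/D.
set a := \int[mu]_v _; set b := \int[mu]_v _; set nf := nu _ _ _ _ _ => ha hb hn hd.
have hab : `|a - b * nf| <= 2 * M * D.
  have -> : a - b * nf = (a - m * nf) - (b - m) * nf by ring.
  apply: (le_trans (ler_normB _ _)); rewrite normrM.
  have -> : 2 * M * D = M * D + D * M by ring.
  by rewrite lerD // ler_pM.
rewrite -hd normrN 2!normrM in hab; apply: le_trans hab.
by rewrite normr_nat -mulrA ler_wpM2l // ler_peMl // ler1n.
Qed.

(** In the two quotients each free energy is replaced by its expectation. This costs one deviation
    at [gamma + dl], one at [gamma - dl] and two at [gamma], which explains the coefficients of [e],
    [beta ^+ 2] and [gamma ^+ 2]. *)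
Lemma mean_field_deviation_le (m dl e : R) : 0 < dl -> 0 < e ->
  \int[mu]_v field_deviation m v <=
  ln 2 / (N%:R * dl) +
  `|(mean_free_energy g beta (gamma + dl) h - mean_free_energy g beta gamma h) / dl - m| +
  `|(mean_free_energy g beta (gamma - dl) h - mean_free_energy g beta gamma h) / dl + m| +
  (4 * e + gaussian_sqr_moment / e * (4 * beta ^+ 2 + (gamma + dl) ^+ 2 +
    (gamma - dl) ^+ 2 + 2 * gamma ^+ 2) / N%:R) / dl.
Proof.
move=> dl0 e0; pose psi x v := free_energy beta x h v; pose p x := mean_free_energy g beta x h.
pose dev x v := `|psi x v - p x|.
have idev x : mu.-integrable setT (EFin \o dev x).
  apply: integrable_norm_EFin; apply: integrableB_EFin.
    exact: sqr_integrable_integrable (free_energy_sqr_integrable _ _ _).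
  exact: integrable_cst_EFin.
set c := ln 2 / _ + `|_ - m| + `|_ + m|.
have pw v : field_deviation m v <=
    c + dl^-1 * (dev (gamma + dl) v + (dev (gamma - dl) v + 2 * dev gamma v)).
  apply: (le_trans (field_energy_deviation _ _ _ _ _ N_gt0 dl0)).
  have tri x y : `|(psi x v - psi gamma v) / dl + y| <=
      `|(p x - p gamma) / dl + y| + dl^-1 * (dev x v + dev gamma v).
    have -> : (psi x v - psi gamma v) / dl + y = (p x - p gamma) / dl + y +
        dl^-1 * ((psi x v - p x) - (psi gamma v - p gamma)) by ring.
    apply: (le_trans (ler_normD _ _)); rewrite lerD2l normrM gtr0_norm ?invr_gt0 //.
    by rewrite ler_wpM2l ?invr_ge0 ?(ltW dl0) // ler_normB.
  have := tri (gamma + dl) (- m); have := tri (gamma - dl) m.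
  rewrite /c /psi /p; set A := dl^-1 * _; set B := dl^-1 * _; set C := dl^-1 * (_ + (_ + _)).
  have split_dev (q a b z : R) : q * (b + (a + 2 * z)) = q * (a + z) + q * (b + z) by ring.
  have -> : C = A + B by exact: split_dev.
  lra.
apply: (le_trans (le_Rintegral_affine (integrable_field_deviation _) (idev _) (idev _)
  (idev _) pw)).
rewrite lerD2l mulrC ler_wpM2r ?invr_ge0 ?(ltW dl0) //.
have D1 := free_energy_abs_deviation beta (gamma + dl) h e0.
have D2 := free_energy_abs_deviation beta (gamma - dl) h e0.
have D3 := free_energy_abs_deviation beta gamma h e0.
apply: (le_trans (lerD D1 (lerD D2 (ler_wpM2l _ D3)))) => //.
by rewrite le_eqVlt; apply/orP; left; apply/eqP; ring.
Qed.

End sk_expectation.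

(** The constant is the derivative at [x], and half the radius of a punctured neighbourhood where
    the quotients are [e]-close to it serves as the step on both sides. *)
Lemma derivable_quotients (R : realType) (p : R -> R) (x e : R) :
  derivable p x 1 -> 0 < e ->
  exists m, exists2 dl, 0 < dl &
    `|(p (x + dl) - p x) / dl - m| < e /\ `|(p (x - dl) - p x) / dl + m| < e.
Proof.
move=> dp e0; exists ('D_1 p x).
have /cvgrPdist_lt /(_ e e0) := dp.
rewrite near_withinE => -[r /= r0 hr].
have r20 : 0 < r / 2 by rewrite divr_gt0.
have hball (y : R) : y != 0 -> `|y| < r -> `|(p (x + y) - p x) / y - 'D_1 p x| < e.
  move=> y0 yr; have := hr y; rewrite /ball_ /= sub0r normrN => /(_ yr y0).
  by rewrite distrC /GRing.scale /= mulr1 mulrC (addrC x).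
exists (r / 2) => //; split.
  apply: hball; first by rewrite gt_eqF.
  by rewrite gtr0_norm // ltr_pdivrMr // ltr_pMr // ltr1n.
have := hball (- (r / 2)); rewrite oppr_eq0 gt_eqF // normrN gtr0_norm //.
rewrite ltr_pdivrMr // ltr_pMr // ltr1n => /(_ isT isT).
by rewrite invrN mulrN -opprD normrN.
Qed.

Theorem theorem1p1 (R : realType)
    (d : nat -> measure_display) (Omega : forall N : nat, measurableType (d N))
    (P : forall N : nat, probability (Omega N) R)
    (g : forall N : nat, disorder N -> {RV (P N) >-> R})
    (g_iid : forall N : nat, iid_standard_gaussian (g N))
    (p : R -> R -> R -> R)
    (p_lim : forall b c k : R,
       mean_free_energy (g N) b c k @[N --> \oo] --> p b c k)
    (beta gamma h : R) (gamma_neq0 : gamma != 0)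
    (p_diff : derivable (fun x : R => p beta x h) gamma 1)
    (n : nat) (n_gt0 : (0 < n)%N)
    (f : ((n * n.-1)./2).-tuple R -> R)
    (f_meas : measurable_fun setT f)
    (f_bounded : exists M : R, forall v, `|f v| <= M) :
  gg_delta (g N) beta gamma h f @[N --> \oo] --> (0 : R).
Proof.
case: n n_gt0 f f_meas f_bounded => // k _ f _ [M0 fM0].
(* The given bound may be 0; a positive one is needed as a divisor. *)
pose M := `|M0| + 1; have M_gt0 : 0 < M by rewrite ltr_wpDl.
have fM v : `|f v| <= M by rewrite (le_trans (fM0 v)) // ler_wpDr // ler_norm.
have g0 : 0 < `|gamma| by rewrite normr_gt0.
apply/cvgr0Pnorm_lt => eps eps0.
(* In the limit the two quotients contribute less than [eta] each and the concentration error, taken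
   with e = dl eta, contributes 4 e / dl = 4 eta. Times 2 M this makes 12 M eta. *)
pose eta := eps * `|gamma| / (12 * M).
have eta0 : 0 < eta by rewrite divr_gt0 ?mulr_gt0.
have [m [dl dl0 [hA hB]]] := derivable_quotients p_diff eta0.
have e0 : 0 < dl * eta by rewrite mulr_gt0.
pose pN N x := mean_free_energy (g N) beta x h.
pose C := gaussian_sqr_moment / (dl * eta) * (4 * beta ^+ 2 + (gamma + dl) ^+ 2 +
    (gamma - dl) ^+ 2 + 2 * gamma ^+ 2).
(* The bound on [|gamma|] times the defect, with the powers of N isolated so that its limit can be
   read off term by term. *)
pose bound N := 2 * M * (ln 2 / dl * N%:R^-1 + `|(pN N (gamma + dl) - pN N gamma) / dl - m| +
  `|(pN N (gamma - dl) - pN N gamma) / dl + m| + (4 * (dl * eta) + C * N%:R^-1) / dl).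
have invN : N%:R^-1 @[N --> \oo] --> (0 : R).
  rewrite -(cvg_shiftS (fun N : nat => N%:R^-1 : R)); exact: cvg_harmonic.
have cbound : bound N @[N --> \oo] --> 2 * M * (ln 2 / dl * 0 +
    `|(p beta (gamma + dl) h - p beta gamma h) / dl - m| +
    `|(p beta (gamma - dl) h - p beta gamma h) / dl + m| + (4 * (dl * eta) + C * 0) / dl).
  apply: cvgM; first exact: cvg_cst.
  apply: cvgD; last first.
    apply: cvgM; last exact: cvg_cst.
    apply: cvgD; first exact: cvg_cst.
    by apply: cvgM => //; exact: cvg_cst.
  apply: cvgD; last first.
    apply: cvg_norm; apply: cvgD; last exact: cvg_cst.
    apply: cvgM; last exact: cvg_cst.
    by apply: cvgB; exact: p_lim.
  apply: cvgD; first by apply: cvgM => //; exact: cvg_cst.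
  apply: cvg_norm; apply: cvgB; last exact: cvg_cst.
  apply: cvgM; last exact: cvg_cst.
  by apply: cvgB; exact: p_lim.
have lim_lt : 2 * M * (ln 2 / dl * 0 +
    `|(p beta (gamma + dl) h - p beta gamma h) / dl - m| +
    `|(p beta (gamma - dl) h - p beta gamma h) / dl + m| + (4 * (dl * eta) + C * 0) / dl) <
    eps * `|gamma|.
  have -> : eps * `|gamma| = 2 * M * (6 * eta).
    by rewrite /eta; field; rewrite gt_eqF.
  rewrite ltr_pM2l ?mulr_gt0 // !mulr0 add0r addr0.
  have -> : 4 * (dl * eta) / dl = 4 * eta by field; rewrite gt_eqF.
  by move: hA hB; lra.
near=> N.
have N0 : (0 < N)%N by near: N; exact: nbhs_infty_gt.
have bN : bound N < eps * `|gamma|.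
  by near: N; exact: (cvgr_lt _ cbound).
rewrite -(ltr_pM2l g0) [X in _ < X]mulrC; apply: le_lt_trans bN.
apply: (@le_trans _ _ (2 * M *
    \int[joint_law (g N)]_v field_deviation beta gamma h m v)).
  exact: gg_delta_le.
rewrite /bound ler_wpM2l ?mulr_ge0 ?(ltW M_gt0) //.
rewrite (_ : ln 2 / dl / N%:R = ln 2 / (N%:R * dl)).
  exact: mean_field_deviation_le.
by rewrite invfM mulrA mulrAC.
Unshelve. all: by end_near.
Qed.
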